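(* Let $G,H$ be torsion-free abelian groups and let $I,J$ be arbitrary sets. Let $(t_i)_{i\in I}$ be a family algebraically independent over $K_{\mathbb Q}(G)$ and let $(u_j)_{j\in J}$ be a family algebraically independent over $K_{\mathbb Q}(H)$. Then $$K_{\mathbb Q}(G)(t_i:i\in I)\cong K_{\mathbb Q}(H)(u_j:j\in J)$$ as fields if and only if $$G\oplus\mathbb Z^{(I)}\cong H\oplus\mathbb Z^{(J)}$$ as groups.
   Context: Torsion-free abelian groups are written additively. For a torsion-free abelian group $G$, the rational group algebra $\mathbb Q[G]$ has the formal monomials $X^g$, $g\in G$, as a $\mathbb Q$-basis, with $X^gX^h=X^{g+h}$. It is an integral domain, and $K_{\mathbb Q}(G)=\operatorname{Frac}\mathbb Q[G]$ is its field of fractions. $\mathbb Z^{(I)}$ denotes the direct sum of copies of $\mathbb Z$ indexed by $I$. Field isomorphisms are isomorphisms of abstract fields. *)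

(* Defs.v *)
From HB Require Import structures.
From mathcomp Require Import all_boot all_order all_algebra.
From mathcomp Require Import finmap.
From mathcomp Require Import fraction.
From mathcomp Require Import boolp classical_sets.
From mathcomp.multinomials Require Import monalg.

Set Implicit Arguments.
Unset Strict Implicit.
Unset Printing Implicit Defensive.

Import GRing.Theory.
Local Open Scope ring_scope.

HB.mixin Record Zmodule_isTorsionFree G of GRing.Zmodule G := {
  torsion_free : forall (x : G) (n : nat), (0 < n)%N -> x *+ n = 0 -> x = 0
}.

#[short(type="torsionFreeZmodType")]
HB.structure Definition TorsionFreeZmodule :=
  {G of Zmodule_isTorsionFree G & GRing.Zmodule G}.

(* The rational group algebra.  Its elements are the finitely supported       *)
(* functions G -> rat, and << g >> is the monomial X^g.  The ring structure   *)
(* of {malg rat[K]} is available only for monoids K in which 1 is the sole    *)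
(* unit, hence not for groups: the convolution product is defined here.       *)
Definition groupAlg (G : zmodType) : Type := {malg rat[G]}.

HB.instance Definition _ (G : zmodType) := 
  GRing.Lmodule.copy (groupAlg G) {malg rat[G]}.

Section GroupAlgRing.
Context (G : zmodType).
Implicit Types (p q r : groupAlg G) (g h : G) (c d : rat).

Definition groupAlg_one : groupAlg G := << 0 >>.

Definition groupAlg_mul p q : groupAlg G :=
  \sum_(g <- msupp p) \sum_(h <- msupp q) << p@_g * q@_h *g g + h >>.

Local Notation mul := groupAlg_mul.

Let mulw (d1 d2 : {fset G}) p q :
  (msupp p `<=` d1)%fset -> (msupp q `<=` d2)%fset ->
  mul p q = \sum_(g <- d1) \sum_(h <- d2) << p@_g * q@_h *g g + h >>.
Proof.
move=> le1 le2; rewrite /mul (big_fset_incl _ le1) /=.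
  apply/eq_bigr=> g _; apply/big_fset_incl => // h _ /mcoeff_outdom ->.
  by rewrite mulr0 monalgU0.
move=> g _ /mcoeff_outdom pg.
by rewrite big1 => // h _; rewrite pg mul0r monalgU0.
Qed.

Let mulUU c d g h : mul << c *g g >> << d *g h >> = << c * d *g g + h >>.
Proof. by rewrite (mulw msuppU_le msuppU_le) !big_seq_fset1 !mcoeffUU. Qed.

Let mulC : commutative mul.
Proof.
move=> p q; rewrite /mul exchange_big; apply: eq_bigr => g _ /=.
by apply: eq_bigr => h _; rewrite mulrC addrC.
Qed.

Let mulDl : left_distributive mul +%R.
Proof.
move=> p q r.
rewrite (mulw (msuppD_le p q) (fsubset_refl _)).
rewrite (mulw (fsubsetUl (msupp p) (msupp q)) (fsubset_refl (msupp r))).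
rewrite (mulw (fsubsetUr (msupp p) (msupp q)) (fsubset_refl (msupp r))).
rewrite -big_split /=; apply/eq_bigr=> g _.
rewrite -big_split /=; apply/eq_bigr=> h _.
by rewrite mcoeffD mulrDl monalgUD.
Qed.

Let mulDr : right_distributive mul +%R.
Proof. by move=> p q r; rewrite mulC mulDl !(mulC p). Qed.

Let mul0 : left_zero 0 mul.
Proof. by move=> p; rewrite /mul msupp0 big_seq_fset0. Qed.

Let mulr_0 : right_zero 0 mul.
Proof. by move=> p; rewrite mulC mul0. Qed.

Let mul_suml (s : seq G) (F : G -> groupAlg G) q :
  mul (\sum_(g <- s) F g) q = \sum_(g <- s) mul (F g) q.
Proof. exact: (big_morph (mul^~ q) (fun _ _ => mulDl _ _ _) (mul0 _)). Qed.

Let mul_sumr (s : seq G) (F : G -> groupAlg G) q :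
  mul q (\sum_(g <- s) F g) = \sum_(g <- s) mul q (F g).
Proof. exact: (big_morph (mul q) (fun _ _ => mulDr _ _ _) (mulr_0 _)). Qed.

Let mulEl p q : mul p q = \sum_(g <- msupp p) mul << p@_g *g g >> q.
Proof. by rewrite {1}[p]monalgE mul_suml. Qed.

Let mulEr p q : mul p q = \sum_(h <- msupp q) mul p << q@_h *g h >>.
Proof. by rewrite {1}[q]monalgE mul_sumr. Qed.

Let mulA : associative mul.
Proof.
move=> p q r; rewrite (mulEl p (mul q r)) (mulEl p q) mul_suml.
apply: eq_bigr => g _; set u := << _ *g g >>.
rewrite (mulEl q r) mul_sumr (mulEr u q) mul_suml.
apply: eq_bigr => h _; set v := << _ *g h >>.
rewrite (mulEr v r) mul_sumr (mulEr (mul u v) r).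
by apply: eq_bigr => k _; rewrite /u /v !mulUU mulrA addrA.
Qed.

Let mul1 : left_id groupAlg_one mul.
Proof.
move=> p; rewrite [in LHS](monalgE p) mul_sumr [RHS]monalgE.
by apply: eq_bigr => g _; rewrite mulUU mul1r add0r.
Qed.

Let one_neq0 : groupAlg_one != 0.
Proof. by rewrite monalgU_eq0 oner_eq0. Qed.

HB.instance Definition _ := GRing.Zmodule_isComNzRing.Build (groupAlg G)
  mulA mulC mul1 mulDl one_neq0.

Let unit_ p : bool := `[< exists q, q * p == 1 >].

Let inv p : groupAlg G :=
  if pselect (exists q, q * p == 1) is left e then xchoose e else p.

Let mulVp : {in unit_, left_inverse 1 inv *%R}.
Proof.
move=> p /asboolP pU; rewrite /inv; case: pselect => // e.
exact/eqP/(xchooseP e).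
Qed.

Let unitP p q : q * p = 1 -> unit_ p.
Proof. by move=> qp; apply/asboolP; exists q; apply/eqP. Qed.

Let inv_out : {in [predC unit_], inv =1 id}.
Proof. by move=> p /asboolP pU; rewrite /inv; case: pselect. Qed.

HB.instance Definition _ :=
  GRing.ComNzRing_hasMulInverse.Build (groupAlg G) mulVp unitP inv_out.

Lemma groupAlg_monomM g h : (<< g >> : groupAlg G) * << h >> = << g + h >>.
Proof. by rewrite [LHS]mulUU mul1r. Qed.

Lemma mcoeff_groupAlgM p q k :
  (p * q)@_k = \sum_(g <- msupp p) \sum_(h <- msupp q)
                 (p@_g * q@_h) *+ (g + h == k).
Proof.
rewrite raddf_sum; apply: eq_bigr => g _.
by rewrite raddf_sum; apply: eq_bigr => h _; rewrite /= mcoeffU.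
Qed.

End GroupAlgRing.

(* A torsion-free abelian group is orderable, so Q[G] is a domain. *)
Section Orderable.
Context (G : torsionFreeZmodType).

Let cone (P : set G) := ~ P 0 /\ forall x y, P x -> P y -> P (x + y).

Let coneMn P x n : cone P -> P x -> (0 < n)%N -> P (x *+ n).
Proof.
case=> _ PD Px; case: n => // n _; elim: n => [|n IH]; first by rewrite mulr1n.
by rewrite mulrS; apply: PD.
Qed.

Lemma torsion_free_cone : exists P : set G,
  [/\ ~ P 0, forall x y, P x -> P y -> P (x + y)
     & forall x, x != 0 -> P x \/ P (- x)].
Proof.
have [|P [cP maxP]] := @Zorn_bigcup G cone.
  move=> F Fc Ftot; split; first by case=> X FX X0; case: (Fc X FX).
  move=> x y [X FX Xx] [Y FY Yy].
  have [XY|YX] := Ftot X Y FX FY.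
    by exists Y => //; apply: (Fc Y FY).2 => //; apply: XY.
  by exists X => //; apply: (Fc X FX).2 => //; apply: YX.
have [P0 PD] := cP.
have ext x : x != 0 -> ~ P x -> exists2 n, (0 < n)%N & P (- x *+ n).
  move=> x0 Px.
  pose Q : set G := fun y => exists p n,
    [/\ P p \/ p = 0, P p \/ (0 < n)%N & y = p + x *+ n].
  have PQ : (P `<` Q)%classic.
    split=> [y Py|QP].
      by exists y, 0%N; rewrite mulr0n addr0; split=> //; left.
    apply: Px; apply: QP; exists 0, 1%N; rewrite add0r mulr1n.
    by split=> //; right.
  apply: contra_notP (maxP _ PQ) => nP; split.
    case=> p [n [p1 p2 /esym/eqP]]; rewrite addr_eq0 => /eqP pE.
    case: n => [|n] in p2 pE.
      by rewrite mulr0n oppr0 in pE; case: p2 => //; rewrite pE.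
    case: p1 => [Pp|p0].
      by apply: nP; exists n.+1 => //; rewrite mulNrn -pE.
    move/eqP: pE; rewrite p0 eq_sym oppr_eq0 => /eqP /torsion_free.
    by move=> /(_ isT) xE; rewrite xE eqxx in x0.
  move=> y z [p [n [p1 p2 ->]]] [q [m [q1 q2 ->]]].
  exists (p + q), (n + m)%N; split; last by rewrite mulrnDr addrACA.
    case: p1 => [Pp|->]; last by rewrite add0r.
    by left; case: q1 => [Pq|->]; rewrite ?addr0 //; apply: PD.
  case: p2 => [Pp|n0]; last by right; rewrite addn_gt0 n0.
  by left; case: q1 => [Pq|->]; rewrite ?addr0 //; apply: PD.
exists P; split=> // x x0.
have [Px|nPx] := pselect (P x); first by left.
have [Pnx|nPnx] := pselect (P (- x)); first by right.
have [n n0 Pn] := ext x x0 nPx.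
have Nx0 : - x != 0 by rewrite oppr_eq0.
have [m m0] := ext (- x) Nx0 nPnx; rewrite opprK => Pm.
case: P0; rewrite -[0](addNr (x *+ (n * m))) -mulNrn.
by apply: PD; [rewrite mulrnA | rewrite mulnC mulrnA]; apply: coneMn.
Qed.

Let le_max (P : set G) (s : seq G) :
  (forall x y, P x -> P y -> P (x + y)) ->
  (forall x, x != 0 -> P x \/ P (- x)) ->
  s != [::] ->
  exists2 a, a \in s & forall x, x \in s -> x = a \/ P (a - x).
Proof.
move=> PD Pt; elim: s => // b s IH _.
have [->|/IH [a a_s amax]] := eqVneq s [::].
  by exists b; rewrite ?mem_seq1 // => x; rewrite mem_seq1 => /eqP; left.
have [eab|/Pt] := eqVneq (a - b) 0.
  exists a; first by rewrite inE a_s orbT.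
  move=> x; rewrite inE => /orP[/eqP->|/amax//].
  by left; apply/esym/eqP; rewrite -subr_eq0 eab.
case=> Pab.
  exists a; first by rewrite inE a_s orbT.
  by move=> x; rewrite inE => /orP[/eqP->|/amax//]; right.
exists b; first by rewrite inE eqxx.
rewrite opprB in Pab => x; rewrite inE => /orP[/eqP->|/amax[->|Pax]].
- by left.
- by right.
- by right; rewrite -(subrKA a); apply: PD.
Qed.

Lemma groupAlg_integral (p q : groupAlg G) :
  p * q = 0 -> (p == 0) || (q == 0).
Proof.
move=> pq0; have [//|p0] := eqVneq p 0; have [//|q0] /= := eqVneq q 0.
have supp_n0 (r : groupAlg G) : r != 0 -> (msupp r : seq G) != [::].
  apply: contra_neq => r0; rewrite [r]monalgE; apply: big1_seq => g.
  by rewrite r0.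
have [P [P0 PD Pt]] := torsion_free_cone.
have [a a_p amax] := le_max PD Pt (supp_n0 p p0).
have [b b_q bmax] := le_max PD Pt (supp_n0 q q0).
have : (p * q)@_(a + b) = p@_a * q@_b.
  rewrite mcoeff_groupAlgM (big_fsetD1 a) //= (big_fsetD1 b) //= eqxx mulr1n.
  rewrite !big1_seq ?addr0 //; last first.
    move=> h /andP[_]; rewrite in_fsetD1 => /andP[hb _].
    by rewrite (inj_eq (addrI a)) (negbTE hb).
  move=> g /andP[_]; rewrite in_fsetD1 => /andP[/eqP ga /amax[//|Pg]].
  apply: big1_seq => h /andP[_ /bmax Ph]; case: eqP => // ghE; case: P0.
  have e : (a - g) + (b - h) = 0 by rewrite addrACA -opprD ghE subrr.
  by rewrite -e; case: Ph => [->|]; [rewrite subrr addr0 | apply: PD].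
rewrite pq0 mcoeff0 => /esym/eqP; rewrite mulf_eq0 !mcoeff_eq0.
by rewrite a_p b_q.
Qed.

HB.instance Definition _ :=
  GRing.ComUnitRing_isIntegral.Build (groupAlg G) groupAlg_integral.

End Orderable.

Notation KQ G := {fraction groupAlg G}.

(* {malg K[{cmonom I}]} is the polynomial ring K[X_i : i in I], with I        *)
(* possibly infinite; a monomial m : {cmonom I} is the finitely supported     *)
(* family of its exponents.                                                   *)
Section Extensions.
Context (K L : fieldType) (iota : {rmorphism K -> L}).
Context (I : choiceType) (t : I -> L).

Definition monom_eval (m : {cmonom I}) : L :=
  \prod_(i <- finsupp m) t i ^+ m i.

Definition alg_independent : Prop :=
  forall p : {malg K[{cmonom I}]}, mmap iota monom_eval p = 0 -> p = 0.

(* K(t_i : i in I), the smallest subfield of L containing K and the t_i. *)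
Definition adjoin_pred : {pred L} := fun x =>
  `[< forall S : {pred L}, GRing.divring_closed S ->
      (forall a, iota a \in S) -> (forall i, t i \in S) -> x \in S >].

Lemma adjoin_pred_closed : GRing.divring_closed adjoin_pred.
Proof.
split.
- by apply/asboolP => S [S1 _ _].
- move=> x y /asboolP Sx /asboolP Sy; apply/asboolP => S cS Sa St.
  by case: (cS) => _ SB _; apply: SB; [apply: Sx | apply: Sy].
- move=> x y /asboolP Sx /asboolP Sy; apply/asboolP => S cS Sa St.
  by case: (cS) => _ _ SM; apply: SM; [apply: Sx | apply: Sy].
Qed.

HB.instance Definition _ :=
  GRing.isDivringClosed.Build L adjoin_pred adjoin_pred_closed.

Record adjoin : predArgType :=
  Adjoin { adjoin_val : L; _ : adjoin_val \in adjoin_pred }.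

HB.instance Definition _ := [isSub for adjoin_val].
HB.instance Definition _ := [Choice of adjoin by <:].
HB.instance Definition _ := [SubChoice_isSubComUnitRing of adjoin by <:].
HB.instance Definition _ := [SubComUnitRing_isSubIntegralDomain of adjoin by <:].
HB.instance Definition _ := [SubIntegralDomain_isSubField of adjoin by <:].

End Extensions.

Definition field_isomorphic (E F : fieldType) : Prop :=
  exists f : {rmorphism E -> F}, bijective f.

Definition group_isomorphic (A B : zmodType) : Prop :=
  exists f : {additive A -> B}, bijective f.

(* Main.v *)
Require Import Defs.
From HB Require Import structures.
From mathcomp Require Import all_boot all_order all_algebra.
From mathcomp Require Import ring.
From mathcomp Require Import finmap.
From mathcomp Require Import generic_quotient fraction.
From mathcomp Require Import separable.
From mathcomp Require Import boolp classical_sets functions cardinality.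
From mathcomp.multinomials Require Import monalg.

Set Implicit Arguments.
Unset Strict Implicit.
Unset Printing Implicit Defensive.

Import Order.TTheory GRing.Theory Num.Theory.
Local Open Scope ring_scope.
Local Open Scope classical_set_scope.
Local Open Scope card_scope.

(** A purely transcendental extension of [KQ G] on a family indexed by [I] is again
    a fraction field of a rational group algebra, that of [G + Z^(I)]: the [t i] are
    the monomials of the new generators ([presentation_adjoin]).  So isomorphic
    groups give isomorphic fields, and for the converse it suffices to recover
    [G] from a field [K] presented as the fraction field of Q[G].

    Suppose that [K] is presented both by [chi : G -> K^*] and by [psi : H -> K^*],
    and let [C] be the group of units common to [Q^* chi(G)] and [Q^* psi(H)], taken
    modulo [Q^*].  It is a subgroup of both [G] and [H].

    The main point is that [G / C] and [H / C] are free
    ([basis_mod_constants]).  Since [G / C] embeds in [K^* / Q^* psi(H)], it is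
    enough to filter this quotient with free steps, because subgroups of free
    groups are free and free steps compose, even transfinitely
    ([basis_mod_coords], [basis_mod_chain]).  The filtration comes from
    the pure subgroups [P] of [H]: with [k = Q(psi P)], a rank one pure extension of
    [P] is a union of groups [P + Z t_n] with [t_n] in [P + m t_(n+1)], so that the
    corresponding fields are the layers [k(t_n)] of a Kummer tower.  At the bottom,
    [k(t)^* / k^* t^Z] is the free group of divisors prime to 0 ([frac_ord0]).  For
    [t = a u^m], the extension [k(u) / k(t)] is unramified outside 0 in
    characteristic 0, and an element of [k(u)^*] belongs to [k(t)^* u^Z] if and only if
    its valuations at any two primes over the same prime of [k[t]] agree
    ([frac_linked]); the differences of such valuations embed the quotient in a direct
    sum of copies of Z.

    Hence [G = C + A] and [H = C + B] with [A], [B] free.  The ranks of [A] and [B] are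
    equal: both are the transcendence degree of [K] over [Q(C)].  This is obtained
    from derivations of [K] that are constant on [C], since each coordinate
    function [G -> Z] is the logarithmic derivative of such a derivation
    ([log_derivation], [basis_card_le]); two exchange arguments and the
    Cantor-Bernstein theorem cover infinite ranks.  Matching the bases of [A] and [B]
    gives the isomorphism ([group_isomorphic_of_presentations]). *)

(** * Bases of a subgroup modulo a smaller one *)

Section RelativeBasis.
Variable G : zmodType.
Implicit Types (A B C X Y : set G) (m : {malg int[G]}).

Definition is_subgroup A := A 0 /\ forall x y, A x -> A y -> A (x - y).

Lemma subgroupN A x : is_subgroup A -> A x -> A (- x).
Proof. by case=> A0 AB Ax; rewrite -sub0r; apply: AB. Qed.

Lemma subgroupD A x y : is_subgroup A -> A x -> A y -> A (x + y).
Proof. by move=> sA Ax Ay; rewrite -[y]opprK; apply: sA.2 => //; exact: subgroupN. Qed.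

Lemma subgroup_sum A (T : eqType) (s : seq T) (F : T -> G) :
  is_subgroup A -> (forall i, i \in s -> A (F i)) -> A (\sum_(i <- s) F i).
Proof.
move=> sA; elim: s => [|i s IH] h; first by rewrite big_nil; case: sA.
rewrite big_cons; apply: subgroupD => //; first by apply: h; rewrite mem_head.
by apply: IH => j js; apply: h; rewrite in_cons js orbT.
Qed.

Lemma subgroupMz A x (n : int) : is_subgroup A -> A x -> A (x *~ n).
Proof.
move=> sA Ax; have key k : A (x *+ k).
  by elim: k => [|k IH]; rewrite ?mulr0n; [case: sA | rewrite mulrS; exact: subgroupD].
by case: n => n; rewrite ?pmulrn -?pmulrn // NegzE mulrNz -pmulrn; exact: subgroupN.
Qed.

Definition int_comb m : G := \sum_(g <- msupp m) g *~ m@_g.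

Lemma int_comb_widen (d : {fset G}) m :
  (msupp m `<=` d)%fset -> int_comb m = \sum_(g <- d) g *~ m@_g.
Proof.
move=> le; rewrite /int_comb (big_fset_incl _ le) //= => x _ /mcoeff_outdom ->.
by rewrite mulr0z.
Qed.

Lemma int_comb_is_additive : zmod_morphism int_comb.
Proof.
move=> m1 m2.
rewrite (int_comb_widen (msuppB_le m1 m2)).
rewrite (int_comb_widen (fsubsetUl (msupp m1) (msupp m2))).
rewrite (int_comb_widen (fsubsetUr (msupp m1) (msupp m2))).
by rewrite -sumrB; apply: eq_bigr => g _; rewrite mcoeffB mulrzBr.
Qed.

HB.instance Definition _ := GRing.isZmodMorphism.Build _ _ int_comb
  int_comb_is_additive.

Lemma int_combU (n : int) (g : G) : int_comb << n *g g >> = g *~ n.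
Proof. by rewrite (int_comb_widen msuppU_le) big_seq_fset1 mcoeffUU. Qed.

Definition supp_in (T : choiceType) (R : zmodType) (X : set T) (m : {malg R[T]}) :=
  forall g, g \in msupp m -> X g.

Lemma int_comb_in A X m : is_subgroup A -> X `<=` A -> supp_in X m -> A (int_comb m).
Proof.
move=> sA XA mX; apply: subgroup_sum => // g gm; apply: subgroupMz => //.
exact/XA/mX.
Qed.

Definition basis_mod A B X :=
  [/\ X `<=` B,
      forall b, B b -> exists2 m, supp_in X m & A (b - int_comb m)
    & forall m, supp_in X m -> A (int_comb m) -> m = 0].

End RelativeBasis.

Section SuppIn.
Variables (T : choiceType) (R : zmodType).
Implicit Types (X Y : set T) (m : {malg R[T]}).

Lemma supp_in0 X : supp_in X (0 : {malg R[T]}).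
Proof. by move=> g; rewrite msupp0 in_fset0. Qed.

Lemma supp_inD X m1 m2 : supp_in X m1 -> supp_in X m2 -> supp_in X (m1 + m2).
Proof.
move=> h1 h2 g /(fsubsetP (msuppD_le m1 m2)); rewrite in_fsetU.
by case/orP => [/h1|/h2].
Qed.

Lemma supp_inN X m : supp_in X m -> supp_in X (- m).
Proof. by move=> h g; rewrite msuppN; exact: h. Qed.

Lemma supp_inB X m1 m2 : supp_in X m1 -> supp_in X m2 -> supp_in X (m1 - m2).
Proof. by move=> h1 h2; apply: supp_inD => //; exact: supp_inN. Qed.

Lemma supp_inU X c g : X g -> supp_in X (<< c *g g >> : {malg R[T]}).
Proof. by move=> Xg h /(fsubsetP msuppU_le); rewrite in_fset1 => /eqP ->. Qed.

Lemma supp_inW X Y m : X `<=` Y -> supp_in X m -> supp_in Y m.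
Proof. by move=> XY mX g /mX /XY. Qed.

Definition restr X m : {malg R[T]} :=
  \sum_(g <- msupp m | `[< X g >]) << m@_g *g g >>.

Lemma restr_supp X m : supp_in (fun g => X g /\ g \in msupp m) (restr X m).
Proof.
rewrite /restr big_seq_cond; apply: (big_ind (@supp_in _ _ _)).
- exact: supp_in0.
- exact: supp_inD.
- by move=> g /andP[gm /asboolP Xg]; apply: supp_inU.
Qed.

Lemma restr_compl X m : m = restr X m + restr (~` X) m.
Proof.
rewrite {1}[m]monalgE (bigID (fun g => `[< X g >])) /=; congr (_ + _).
by apply: eq_bigl => g; rewrite asbool_neg.
Qed.

End SuppIn.

Section BasisConstructions.
Variable G : zmodType.
Implicit Types (A B C X Y : set G) (m : {malg int[G]}).

Lemma basis_mod_refl A : basis_mod A A set0.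
Proof.
split=> // [b Ab|m m0 _].
  by exists 0; [exact: supp_in0 | rewrite raddf0 subr0].
by apply/malgP => g; rewrite mcoeff0; apply: mcoeff_outdom; apply/negP => /m0.
Qed.

(** The coefficients of [g] on a basis modulo [A] are unique, hence additive in
    [g]: every basis element yields a homomorphism [G -> Z]. *)
Lemma basis_mod_coord A X : is_subgroup A -> basis_mod A setT X ->
  exists r : G -> {malg int[G]},
  [/\ forall g, supp_in X (r g), forall g, A (g - int_comb (r g)),
      forall g h, r (g - h) = r g - r h
    & forall g m, supp_in X m -> A (g - int_comb m) -> r g = m].
Proof.
move=> sA [_ gen ind].
have [r hr] : exists r : G -> {malg int[G]}, forall g,
  supp_in X (r g) /\ A (g - int_comb (r g)).
  have h g : exists m, supp_in X m /\ A (g - int_comb m) by have [m] := gen g I;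
    exists m.
  by have [r] := choice h; exists r.
have uniq g m : supp_in X m -> A (g - int_comb m) -> r g = m.
  move=> mX Am; apply/eqP; rewrite -subr_eq0; apply/eqP/ind.
    by apply: supp_inB => //; case: (hr g).
  have -> : int_comb (r g - m) = (g - int_comb m) - (g - int_comb (r g)).
    by rewrite raddfB opprB [RHS]addrC addrA subrK.
  by apply: sA.2 => //; case: (hr g).
exists r; split=> // [g|g|g h]; [by case: (hr g) | by case: (hr g) | apply: uniq].
  by apply: supp_inB; [case: (hr g) | case: (hr h)].
have -> : g - h - int_comb (r g - r h) = (g - int_comb (r g)) - (h - int_comb (r h)).
  by rewrite raddfB !opprB [LHS]addrACA [RHS]addrACA [- h + _]addrC.
by apply: sA.2; [case: (hr g) | case: (hr h)].
Qed.

(** The elements outside [X] are read off modulo [B] first; what remains is a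
    relation on [X] modulo [A]. *)
Lemma basis_mod_trans A B C X Y : is_subgroup B -> A `<=` B -> B `<=` C ->
  basis_mod A B X -> basis_mod B C Y -> basis_mod A C (X `|` Y).
Proof.
move=> sB AB BC [XB Xg Xi] [YC Yg Yi]; split.
- by move=> g [/XB/BC|/YC].
- move=> c /Yg[m mY /Xg [m' mX h]]; exists (m + m').
    apply: supp_inD; first by apply: supp_inW mY => g; right.
    by apply: supp_inW mX => g; left.
  by rewrite raddfD opprD addrA.
move=> m mXY Am.
have mX : supp_in X (restr X m) by move=> g /restr_supp[].
have mY : supp_in Y (restr (~` X) m).
  by move=> g /restr_supp[nX /mXY[]].
have e := restr_compl X m.
have mY0 : restr (~` X) m = 0.
  apply: Yi => //; rewrite -[restr _ m](addKr (restr X m)) -e raddfD raddfN addrC.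
  by apply: sB.2; [exact: AB | exact: int_comb_in mX].
by rewrite e mY0 addr0; apply: Xi => //; rewrite mY0 addr0 in e; rewrite -e.
Qed.

(** Transfinite iteration of [basis_mod_trans], run on a chain-complete family
    of index sets instead of on ordinals: a maximal partial basis exists, and a
    successor step would enlarge it. *)
Lemma basis_mod_chain (T : Type) (ok : set (set T)) (S : set T -> set G)
    (Q0 Q1 : set T) :
  (forall Q, ok Q -> is_subgroup (S Q)) ->
  (forall Q Q', ok Q -> ok Q' -> Q `<=` Q' -> S Q `<=` S Q') ->
  ok Q0 ->
  (forall F : set (set T), F !=set0 -> F `<=` ok -> total_on F subset ->
     ok (\bigcup_(Q in F) Q) /\
     S (\bigcup_(Q in F) Q) `<=` \bigcup_(Q in F) S Q) ->
  (forall Q, ok Q -> Q0 `<=` Q -> Q <> Q1 ->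
     exists Q', [/\ ok Q', Q `<` Q' & exists X, basis_mod (S Q) (S Q') X]) ->
  exists X, basis_mod (S Q0) (S Q1) X.
Proof.
move=> sub mono ok0 chain step.
(* A pair (index set, partial basis) is coded by one subset of [T + G], so that
   Zorn's lemma for inclusion applies; [Q0] is adjoined to the index set in
   order that the empty chain be bounded. *)
pose Qof (U : set (T + G)) : set T := Q0 `|` [set t | U (inl t)].
pose Xof (U : set (T + G)) : set G := [set g | U (inr g)].
have [|U [[okU bU] maxU]] := @Zorn_bigcup (T + G)
    (fun U => ok (Qof U) /\ basis_mod (S Q0) (S (Qof U)) (Xof U)).
  move=> F FP Ftot.
  have [[U0 FU0]|F0] := pselect (F !=set0); last first.
    have F00 : F = set0 by apply/seteqP; split=> // U FU; apply: F0; exists U.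
    rewrite F00 bigcup_set0.
    have -> : Qof set0 = Q0 by apply/seteqP; split=> t //; [case | left].
    have -> : Xof set0 = set0 by [].
    by split=> //; exact: basis_mod_refl.
  pose FQ := [set Qof U | U in F].
  have QE : Qof (\bigcup_(U in F) U) = \bigcup_(Q in FQ) Q.
    apply/seteqP; split=> t.
      case=> [Q0t|[U FU Ut]]; first by exists (Qof U0); [exists U0 | left].
      by exists (Qof U); [exists U | right].
    by case=> _ [U FU <-] [Q0t|Ut]; [left | right; exists U].
  have Fle U V : U `<=` V -> Qof U `<=` Qof V.
    by move=> UV t [|/UV]; [left | right].
  have [||| okF SF] := chain FQ.
  - by exists (Qof U0), U0.
  - by move=> _ [U FU <-]; case: (FP U FU).
  - move=> _ _ [U FU <-] [V FV <-].
    by case: (Ftot U V FU FV) => /Fle h; [left|right].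
  rewrite QE; split=> //.
  have leF U : F U -> S (Qof U) `<=` S (\bigcup_(Q in FQ) Q).
    move=> FU; apply: mono => //; first by case: (FP U FU).
    by move=> t Ut; exists (Qof U) => //; exists U.
  split.
  - by move=> g [U FU Ug]; apply: (leF U FU); case: (FP U FU) => _ [h _ _]; apply: h.
  - move=> b /SF[_ [U FU <-]] Sb; case: (FP U FU) => _ [_ h _].
    have [m mX hm] := h b Sb; exists m => //.
    by apply: supp_inW mX => g Ug; exists U.
  - move=> m mX Am.
    have [U FU mU] : exists2 U, F U & supp_in (Xof U) m.
      suff h (s : seq G) : (forall g, g \in s -> Xof (\bigcup_(U in F) U) g) ->
          exists2 U, F U & forall g, g \in s -> Xof U g.
        by have [U] := h (msupp m) mX; exists U.
      elim: s => [|g s IH] h; first by exists U0.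
      have [|U FU hU] := IH; first by move=> k ks; apply: h; rewrite in_cons ks orbT.
      have [V FV Vg] := h g (mem_head _ _).
      case: (Ftot U V FU FV) => UV.
        exists V => // k; rewrite in_cons => /orP[/eqP -> //|/hU]; exact: UV.
      by exists U => // k; rewrite in_cons => /orP[/eqP ->|/hU //]; apply: UV.
    by case: (FP U FU) => _ [_ _ h]; apply: h.
have [QU|QU] := pselect (Qof U = Q1); first by exists (Xof U); rewrite -QU.
have [|Q' [okQ' QQ' [X bX]]] := step _ okU _ QU; first by move=> t; left.
pose V : set (T + G) := fun z => match z with
  | inl t => Q' t | inr g => (Xof U `|` X) g end.
have VE : Qof V = Q'.
  apply/seteqP; split=> t; first by case=> // Q0t; apply: (properW QQ'); left.
  by right.
have /maxU [] : U `<` V.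
  split=> [[t Ut|g Ug]|VU].
  - by apply: (properW QQ'); right.
  - by left.
  case: QQ' => _; apply=> t Q't; right; exact: (VU (inl t)).
rewrite VE; split=> //.
have QQs := properW QQ'.
apply: (basis_mod_trans _ _ _ bU bX); [exact: sub | | exact: mono].
by apply: mono => // t; left.
Qed.

(** A subgroup of Z is cyclic: the generator is lifted to [B]. *)
Lemma basis_mod_int B (c : G -> int) : is_subgroup B ->
  (forall x y, B x -> B y -> c (x - y) = c x - c y) ->
  exists X, basis_mod [set b | B b /\ c b = 0] B X.
Proof.
move=> sB cB; set A := [set b | _].
have c0 : c 0 = 0 by rewrite -{1}(subrr (0 : G)) cB ?subrr //; case: sB.
have cN x : B x -> c (- x) = - c x.
  by move=> Bx; rewrite -sub0r cB ?c0 ?sub0r //; case: sB.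
have cD x y : B x -> B y -> c (x + y) = c x + c y.
  by move=> Bx By; rewrite -[y]opprK cB ?cN ?opprK //; exact: subgroupN.
have cMn x n : B x -> c (x *+ n) = c x *+ n.
  move=> Bx; elim: n => [|n IH]; first by rewrite !mulr0n.
  by rewrite !mulrS cD ?IH //; apply: (subgroupMz (Posz n)).
have cMz x (n : int) : B x -> c (x *~ n) = c x *~ n.
  by move=> Bx; case: n => n; rewrite ?NegzE ?mulrNz ?cN -?pmulrn ?cMn //;
    apply: (subgroupMz (Posz n.+1)).
have sA : is_subgroup A.
  split; first by split => //; case: sB.
  by move=> x y [Bx cx] [By cy]; split; [apply: sB.2 | rewrite cB // cx cy subrr].
have [[b Bb cb]|allA] := pselect (exists2 b, B b & c b <> 0); last first.
  have -> : A = B; last by exists set0; exact: basis_mod_refl.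
  apply/seteqP; split=> b; first by case.
  move=> Bb; split=> //; apply: contrapT => cb; apply: allA; by exists b.
have ex : exists n, `[< (0 < n)%N /\ exists2 x, B x & c x = n%:Z >].
  exists `|c b|%N; apply/asboolP; split; first by rewrite absz_gt0; apply/eqP.
  have [cb0|cb0] := lerP 0 (c b); first by exists b => //; rewrite gez0_abs.
  by exists (- b); [exact: subgroupN | rewrite cN // ltz0_abs].
case: (ex_minnP ex) => d /asboolP[d0 [x Bx cx]] dmin.
exists [set x]; split.
- by move=> _ ->.
- move=> y By; exists << (c y %/ d%:Z)%Z *g x >>; first exact: supp_inU.
  rewrite int_combU; have Bz : B (x *~ (c y %/ d%:Z)%Z) by exact: subgroupMz.
  split; first by apply: sB.2.
  set z := y - _; have Bzz : B z by apply: sB.2.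
  have cz : c z = (c y %% d%:Z)%Z.
    by rewrite /z cB // cMz // cx -mulrzr intz mulrC; apply/eqP;
      rewrite subr_eq addrC -divz_eq.
  have cz0 : 0 <= c z by rewrite cz modz_ge0 // -lt0n.
  apply/eqP/negPn/negP => nz.
  have : (d <= `|c z|)%N.
    apply: dmin; apply/asboolP; split; first by rewrite absz_gt0.
    by exists z => //; rewrite gez0_abs.
  rewrite leqNgt => /negP; apply; rewrite -ltz_nat gez0_abs // cz.
  by apply: ltz_pmod.
move=> m mX; have -> : m = << m@_x *g x >>.
  apply/malgP => g; rewrite mcoeffU; case: eqP => [-> //|xg].
  by apply: mcoeff_outdom; apply/negP => /mX /esym.
rewrite int_combU => -[_]; rewrite cMz // cx => /eqP.
by rewrite mulrz_eq0 => /orP[/eqP ->|]; [rewrite monalgU0 | rewrite eqz_nat;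
  case: d d0 {cx dmin}].
Qed.

(** A subgroup of a free abelian group is free: [c] embeds [B] modulo its
    common kernel in the direct sum of copies of Z indexed by [Sigma], and the
    coordinates are adjoined one at a time. *)
Lemma basis_mod_coords (Sigma : eqType) B (c : Sigma -> G -> int) :
  is_subgroup B ->
  (forall s x y, B x -> B y -> c s (x - y) = c s x - c s y) ->
  (forall x, B x -> exists F : seq Sigma, forall s, c s x <> 0 -> s \in F) ->
  exists X, basis_mod [set b | B b /\ forall s, c s b = 0] B X.
Proof.
move=> sB cB cfin.
pose S (Q : set Sigma) := [set b | B b /\ forall s, ~ Q s -> c s b = 0].
have sS Q : is_subgroup (S Q).
  have B0 : B 0 by case: sB.
  split; first by split=> // s _; rewrite -(subrr (0 : G)) cB // subrr.
  move=> x y [Bx cx] [By cy]; split; first exact: sB.2.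
  by move=> s Qs; rewrite cB // cx // cy // subrr.
have -> : [set b | B b /\ forall s, c s b = 0] = S set0.
  by apply/seteqP; split=> b [Bb h]; split=> // s; apply: h.
have -> : B = S setT.
  by apply/seteqP; split=> [b Bb|b []//]; split=> // s /(_ I).
apply: (@basis_mod_chain Sigma setT S set0 setT) => //.
- by move=> Q Q' _ _ QQ' b [Bb h]; split=> // s nQ'; apply: h => /QQ'.
- move=> F [Q0 FQ0] _ Ftot; split=> // b [Bb h].
  have [s hs] := cfin b Bb.
  suff [Q FQ hQ] : exists2 Q, F Q & forall t : Sigma, t \in s -> c t b <> 0 -> Q t.
    exists Q => //; split=> // t nQt; apply: contrapT => ctb.
    by apply: nQt; apply: hQ => //; apply: hs.
  elim: s {hs} => [|t s [Q FQ IH]]; first by exists Q0.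
  have [ct|ct] := pselect (c t b = 0).
    by exists Q => // t'; rewrite in_cons => /orP[/eqP ->|/IH].
  have [Q' FQ' Q't] : (\bigcup_(Q in F) Q) t by apply: contrapT => /h.
  case: (Ftot Q Q' FQ FQ') => QQ'.
    exists Q' => // t'; rewrite in_cons => /orP[/eqP -> //|t's ct']; apply: QQ';
      exact: IH.
  exists Q => // t'; rewrite in_cons => /orP[/eqP -> _|t's ct'];
    [exact: QQ' | exact: IH].
- move=> Q _ _ QT.
  have [s Qs] : exists s, ~ Q s.
    apply: contrapT => nQ; apply: QT; apply/seteqP; split=> // s _.
    by apply: contrapT => Qs; apply: nQ; exists s.
  exists (Q `|` [set s]); split=> //.
    by split=> [t|h]; [left | apply: Qs; apply: h; right].
  have [||X hX] := @basis_mod_int (S (Q `|` [set s])) (c s).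
  - exact: sS.
  - by move=> x y [Bx _] [By _]; exact: cB.
  exists X; congr (basis_mod _ _ _): hX.
  apply/seteqP; split=> b.
    case=> [[Bb h] csb]; split=> // t Qt; have [->//|ts] := pselect (t = s).
    by apply: h => -[].
  by case=> Bb h; split; [split=> // t nQ; apply: h => Qt; apply: nQ; left | exact: h].
Qed.

(** The index sets are the initial segments of nat; [setT] stands for the
    union of the sequence. *)
Lemma basis_mod_omega (S : nat -> set G) :
  (forall n, is_subgroup (S n)) -> (forall n, S n `<=` S n.+1) ->
  (forall n, exists X, basis_mod (S n) (S n.+1) X) ->
  exists X, basis_mod (S 0%N) (\bigcup_n S n) X.
Proof.
move=> sS Sle step.
have Smono (k n : nat) : (k <= n)%N -> S k `<=` S n.
  elim: n => [|n IH]; first by rewrite leqn0 => /eqP ->.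
  rewrite leq_eqVlt => /orP[/eqP -> //|]; rewrite ltnS => /IH h x /h; exact: Sle.
pose SS (Q : set nat) := \bigcup_(n in [set n | forall i, (i < n)%N -> Q i]) S n.
have -> : S 0%N = SS set0.
  apply/seteqP; split=> x; first by exists 0%N.
  by case=> -[|n] h // _; case: (h 0%N).
have -> : \bigcup_n S n = SS setT.
  by apply/seteqP; split=> x [n _ Sx]; exists n.
apply: (@basis_mod_chain nat
  (fun Q => forall i j, (i <= j)%N -> Q j -> Q i) SS set0 setT) => //.
- move=> Q _; split; first by exists 0%N => //; case: (sS 0%N).
  move=> x y [n hn Sx] [k hk Sy]; exists (maxn n k).
    by move=> i; rewrite leq_max => /orP[/hn|/hk].
  apply: (sS _).2; [apply: Smono Sx | apply: Smono Sy].
    exact: leq_maxl.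
  exact: leq_maxr.
- by move=> Q Q' _ _ QQ' x [n hn Sx]; exists n => // i /hn/QQ'.
- move=> F [Q0 FQ0] Fok _; split.
    by move=> i j ij [Q FQ Qj]; exists Q => //; apply: (Fok Q FQ) Qj.
  move=> x [[|n] hn Sx]; first by exists Q0 => //; exists 0%N.
  have [Q FQ Qn] := hn n (ltnSn n); exists Q => //; exists n.+1 => //.
  by move=> i; rewrite ltnS => /(Fok Q FQ); apply.
move=> Q okQ _ QT.
have ex : exists n, ~~ `[< Q n >].
  apply: contrapT => h; apply: QT; apply/seteqP; split=> // n _.
  by apply: contrapT => Qn; apply: h; exists n; apply/asboolPn.
case: (ex_minnP ex) => n /asboolPn nQn nmin.
have Qn i : (i < n)%N -> Q i.
  move=> lt; apply: contrapT => Qi.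
  by have := nmin i; rewrite leqNgt lt => /(_ _)/negP; apply => //; apply/asboolPn.
have Qlt i : Q i -> (i < n)%N.
  by move=> Qi; rewrite ltnNge; apply/negP => ni; apply: nQn; apply: okQ Qi.
exists [set i | (i < n.+1)%N]; split.
- by move=> i j ij; rewrite /= !ltnS; exact: leq_trans.
- split=> [i /Qlt|h]; first by move=> /=; exact: ltnW.
  by apply: nQn; apply: h => /=.
have -> : SS Q = S n.
  apply/seteqP; split=> x; last by exists n.
  case=> k hk; apply: Smono; rewrite leqNgt; apply/negP => /hk; exact: nQn.
have -> : SS [set i | (i < n.+1)%N] = S n.+1.
  apply/seteqP; split=> x; last by exists n.+1.
  case=> k hk; apply: Smono; rewrite leqNgt; apply/negP => /hk /=.
  by rewrite ltnn.
exact: step.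
Qed.

End BasisConstructions.

(** * Exchange in a finitary closure operator *)

Section Exchange.
Variables (T : choiceType) (cl : set T -> set T).
Hypothesis cl_ext : forall X, X `<=` cl X.
Hypothesis cl_mono : forall X Y, X `<=` Y -> cl X `<=` cl Y.
Hypothesis cl_idem : forall X, cl (cl X) `<=` cl X.
Hypothesis cl_exchange : forall X a b,
  cl (X `|` [set a]) b -> ~ cl X b -> cl (X `|` [set b]) a.
Hypothesis cl_fin : forall X b, cl X b ->
  exists2 s : seq T, (forall x, x \in s -> X x) & cl [set` s] b.
Implicit Types (A B X : set T) (F : set (T * T)).

Definition cl_independent X := forall x, X x -> ~ cl (X `\ x) x.

Lemma cl_independentU X b :
  cl_independent X -> ~ cl X b -> cl_independent (X `|` [set b]).
Proof.
move=> iX nb x [Xx|->] h.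
  have [xb|xb] := pselect (x = b); first by apply: nb; rewrite -xb; apply: cl_ext.
  apply: nb.
  have h' : cl (X `\ x `|` [set b]) x.
    by apply: cl_mono h => y [[Xy|->] yx]; [left | right].
  have := cl_exchange h' (iX x Xx).
  apply: cl_mono => y [[]//|->//].
by apply: nb; apply: cl_mono h => y [[//|yb]] /(_ yb).
Qed.

(** [F] is a partial injection from [A] to [B]; replacing its domain by its
    range keeps [A] independent.  A maximal such [F] is total: while some
    [a] in [A] is left, [B] is not contained in the closure of the others, and
    any [b] in [B] outside of it may be paired with [a]. *)
Lemma cl_independent_card_le A B :
  cl_independent A -> (forall x, cl B x) -> A #<= B.
Proof.
move=> iA clB.
pose dom F := [set a | exists b, F (a, b)].
pose ran F := [set b | exists a, F (a, b)].
pose swap F := A `\` dom F `|` ran F.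
pose P F := [/\ (forall a b, F (a, b) -> A a /\ B b),
  (forall a b b', F (a, b) -> F (a, b') -> b = b'),
  (forall a a' b, F (a, b) -> F (a', b) -> a = a'),
  (forall x, ran F x -> A x -> dom F x) & cl_independent (swap F)].
have [|F [[FAB Ffun Finj Fdisj Find] Fmax]] := @Zorn_bigcup (T * T)%type P.
  move=> FF FP Ftot.
  have two p q : (\bigcup_(F in FF) F) p -> (\bigcup_(F in FF) F) q ->
      exists F, [/\ FF F, F p & F q].
    move=> [F FF_F Fp] [F' FF_F' Fq].
    by case: (Ftot F F' FF_F FF_F') => le; [exists F' | exists F]; split=> //;
      apply: le.
  split.
  - by move=> a b [F /FP[h _ _ _ _] /h].
  - by move=> a b b' h h'; have [F [/FP[_ f _ _ _] p q]] := two _ _ h h'; apply: f p q.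
  - by move=> a a' b h h'; have [F [/FP[_ _ f _ _] p q]] := two _ _ h h'; apply: f p q.
  - move=> x [a [F FFF Fax]] Ax; case: (FP F FFF) => _ _ _ h _.
    by have [|b Fxb] := h x _ Ax; [exists a | exists b, F].
  move=> x Ux /cl_fin[s sU clx].
  have [[F0 FF0]|nF] := pselect (FF !=set0); last first.
    apply: (iA x).
      by case: Ux => [[]//|[a [F FFF _]]]; case: nF; exists F.
    apply: cl_mono clx => y /sU [[[Ay _]|[a [F FFF _]]] yx //].
    by case: nF; exists F.
  have key y : swap (\bigcup_(F in FF) F) y ->
      exists2 F, FF F & forall F', FF F' -> F `<=` F' -> swap F' y.
    case=> [[Ay ny]|[a [F FFF Fay]]].
      exists F0 => // F' FF' _; left; split=> // -[b F'b]; apply: ny; exists b.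
      by exists F'.
    by exists F => // F' FF' FF'le; right; exists a; apply: FF'le.
  have [F FFF [Fx Fs]] : exists2 F, FF F & swap F x /\
      forall y : T, y \in s -> swap F y.
    have [Fx FFx hx] := key x Ux.
    suff [F FFF [FxF hF]] : exists2 F, FF F & Fx `<=` F /\
        forall y : T, y \in s ->
          forall F', FF F' -> F `<=` F' -> swap F' y.
      exists F => //; split; first exact: hx.
      by move=> y /hF; apply.
    have : forall y : T, y \in s -> swap (\bigcup_(F in FF) F) y.
      by move=> y /sU[].
    elim: s {clx sU} => [|y s IH] sU; first by exists Fx => //; split.
    have [|F FFF [FxF hF]] := IH; first by move=> z zs; apply: sU;
      rewrite in_cons zs orbT.
    have [Fy FFy hy] := key y (sU y (mem_head _ _)).
    case: (Ftot F Fy FFF FFy) => le; [exists Fy => // | exists F => //]; split.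
    - exact: subset_trans le.
    - move=> z; rewrite in_cons => /orP[/eqP -> //|zs] F' FF' le'.
      by apply: (hF z zs) => //; apply: subset_trans le'.
    - by [].
    - move=> z; rewrite in_cons => /orP[/eqP -> |zs] F' FF' le'; last exact: (hF z zs).
      by apply: hy => //; apply: subset_trans le'.
  case: (FP F FFF) => _ _ _ _ /(_ x Fx); apply.
  by apply: cl_mono clx => y ys; split; [exact: Fs | case: (sU y ys)].
have Ftotal a : A a -> dom F a.
  move=> Aa; apply: contrapT => nFa.
  have Sa : swap F a by left.
  have [b Bb nb] : exists2 b, B b & ~ cl (swap F `\ a) b.
    apply: contrapT => h; apply: (Find a Sa).
    apply: cl_idem; apply: cl_mono (clB a) => b Bb.
    by apply: contrapT => nb; apply: h; exists b.
  have nran : ~ ran F a by move=> /Fdisj /(_ Aa).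
  have nSb x : swap F x -> x <> a -> x <> b.
    by move=> Sx xa xb; apply: nb; apply: cl_ext; rewrite -xb.
  have ranb x : ~ F (x, b).
    move=> Fxb; apply: (nSb b) => //; first by right; exists x.
    by move=> ba; apply: nran; rewrite -ba; exists x.
  apply: (Fmax (F `|` [set (a, b)])).
    split=> [p Fp|h]; first by left.
    by apply: nFa; exists b; apply: h; right.
  split.
  - by move=> x y [/FAB//|[-> ->]].
  - move=> x y y' [h|[xa ->]] [h'|[xa' ->]] //; first exact: Ffun h h'.
      by case: nFa; rewrite -xa'; exists y.
    by case: nFa; rewrite -xa; exists y'.
  - move=> x x' y [h|[-> yb]] [h'|[-> yb']] //; first exact: Finj h h'.
      by case: (ranb x); rewrite -yb'.
    by case: (ranb x'); rewrite -yb.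
  - move=> x [y [Fyx|[_ xb]]] Ax.
      by have [|z] := Fdisj x _ Ax; [exists y | exists z; left].
    have [xa|xa] := pselect (x = a); first by exists b; right; rewrite xa.
    have [[z Fxz]|nFx] := pselect (dom F x); first by exists z; left.
    by case: (nSb x) => //; left.
  have -> : swap (F `|` [set (a, b)]) = swap F `\ a `|` [set b].
    apply/seteqP; split=> x.
      case=> [[Ax nx]|[y [Fyx|[_ ->]]]]; last by right.
        left; split; last by move=> xa; apply: nx; exists b; right; rewrite xa.
        by left; split=> // -[y Fxy]; apply: nx; exists y; left.
      left; split; first by right; exists y.
      by move=> xa; apply: nran; rewrite -xa; exists y.
    case=> [[[[Ax nx]|[y Fyx]] xa]|->]; last by right; exists a; right.
      by left; split=> // -[y [Fxy|[/xa]]] //; apply: nx; exists y.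
    by right; exists y; left.
  apply: cl_independentU nb => x [Sx xa] h; apply: (Find x Sx).
  by apply: cl_mono h => y [[]].
have [f hf] : exists f : T -> T, forall a, A a -> F (a, f a).
  have h a : exists b, A a -> F (a, b).
    have [/Ftotal[b Fab]|nA] := pselect (A a); first by exists b.
    by exists a.
  by have [f hf] := choice h; exists f.
have [|g] := (@injfunPex _ _ A B).2; last exact: inj_card_le.
exists f; first by move=> a /hf/FAB[].
by move=> a a' /set_mem /hf h /set_mem /hf h' e; apply: Finj h _; rewrite e.
Qed.

End Exchange.

Lemma card_eq_set_bij (T U : Type) (u0 : U) (A : set T) (B : set U) :
  A #= B -> exists f : T -> U, set_bij A B f.
Proof.
case/card_bijP => f [g fK gK].
pose F x := if pselect (A x) is left Ax then val (f (SigSub (mem_set Ax))) else u0.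
have FE x (Ax : A x) : F x = val (f (SigSub (mem_set Ax))).
  by rewrite /F; case: pselect => // Ax'; congr (val (f _)); apply/val_inj.
exists F; split.
- by move=> x Ax; rewrite FE; apply: set_mem; exact: (valP (f _)).
- move=> x y /set_mem Ax /set_mem Ay; rewrite (FE x Ax) (FE y Ay) => /val_inj.
  by move=> /(can_inj fK)/(congr1 val).
- move=> y By; pose z := g (SigSub (mem_set By)).
  have Az : A (val z) by apply: set_mem; exact: (valP z).
  exists (val z) => //; rewrite (FE _ Az).
  have -> : SigSub (mem_set Az) = z by apply/val_inj.
  by rewrite gK.
Qed.

(** * Multiplicities of irreducible polynomials *)

Section Multiplicity.
Variable k : fieldType.
Implicit Types (p q r pi : {poly k}).

Definition mult pi p : nat := \max_(e < size p | pi ^+ e %| p) e.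

Lemma dvdp_exp_mult pi p e : (1 < size pi)%N -> p != 0 ->
  (pi ^+ e %| p) = (e <= mult pi p)%N.
Proof.
move=> pi1 p0; apply/idP/idP => [h|le].
  have lt : (e < size p)%N.
    apply: leq_trans (dvdp_leq p0 h).
    have : (0 < size (pi ^+ e))%N by rewrite size_poly_gt0 expf_neq0 //
      -size_poly_gt0 ltnW.
    move=> /prednK <-; rewrite ltnS size_exp leq_pmull //.
    by case: (size pi) pi1 => [|[]].
  exact: (@leq_bigmax_cond _ _ (fun i : 'I_(size p) => nat_of_ord i) (Ordinal lt)).
have [i hi E] : exists2 i : 'I_(size p), pi ^+ i %| p & mult pi p = i.
  have [|i hi E] := @eq_bigmax_cond _ [pred e : 'I_(size p) | pi ^+ e %| p]
    (@nat_of_ord _).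
    apply/card_gt0P; have lt : (0 < size p)%N by rewrite size_poly_gt0.
    by exists (Ordinal lt); rewrite inE expr0 dvd1p.
  by exists i => //; rewrite -E; apply: eq_bigl.
rewrite E in le.
by apply: dvdp_trans hi; exact: dvdp_exp2l.
Qed.

Lemma mult_unique pi p e : (1 < size pi)%N -> p != 0 -> ~~ (pi %| p) ->
  mult pi (pi ^+ e * p) = e.
Proof.
move=> pi1 p0 np; have pi0 : pi != 0 by rewrite -size_poly_gt0 ltnW.
have pp0 : pi ^+ e * p != 0 by rewrite mulf_neq0 // expf_neq0.
apply/eqP; rewrite eqn_leq -dvdp_exp_mult // dvdp_mulr // andbT.
rewrite leqNgt -dvdp_exp_mult // exprSr dvdp_mul2l ?expf_neq0 //.
Qed.

Lemma mult_factor pi p : (1 < size pi)%N -> p != 0 ->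
  exists2 r, p = pi ^+ mult pi p * r & ~~ (pi %| r).
Proof.
move=> pi1 p0; have pi0 : pi != 0 by rewrite -size_poly_gt0 ltnW.
have := leqnn (mult pi p); rewrite -dvdp_exp_mult // => /dvdpP[r E].
exists r; first by rewrite mulrC.
apply/negP => /dvdpP[r' E']; have := ltnn (mult pi p).
by rewrite -dvdp_exp_mult // {2}E E' -mulrA -exprS dvdp_mull.
Qed.

Lemma mult_eq0 pi p : (1 < size pi)%N -> p != 0 -> (mult pi p == 0%N) = ~~ (pi %| p).
Proof. by move=> pi1 p0; rewrite -leqn0 leqNgt -dvdp_exp_mult // expr1. Qed.

Lemma irredp_dvdM pi p q : irreducible_poly pi ->
  (pi %| p * q) = (pi %| p) || (pi %| q).
Proof.
move=> irr; apply/idP/orP => [|[h|h]]; [|exact: dvdp_mulr|exact: dvdp_mull].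
have [|np] := boolP (pi %| p); first by left.
by rewrite Gauss_dvdpr ?irreducible_poly_coprime //; right.
Qed.

Lemma multM pi p q : irreducible_poly pi -> p != 0 -> q != 0 ->
  mult pi (p * q) = (mult pi p + mult pi q)%N.
Proof.
move=> irr p0 q0; have pi1 := irr.1.
have [p' pE np'] := mult_factor pi1 p0; have [q' qE nq'] := mult_factor pi1 q0.
rewrite [in LHS]pE [in LHS]qE mulrACA -exprD mult_unique //.
  rewrite mulf_neq0 //; first by apply: contraNneq np' => ->; rewrite dvdp0.
  by apply: contraNneq nq' => ->; rewrite dvdp0.
by rewrite irredp_dvdM // negb_or np'.
Qed.

Definition monic_irred pi := irreducible_poly pi /\ pi \is monic.

Lemma monic_irred_eq pi pi' :
  monic_irred pi -> monic_irred pi' -> pi %| pi' -> pi = pi'.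
Proof.
move=> [irr mon] [irr' mon'] h; apply/eqP; rewrite -eqp_monic //.
by apply: irr'.2 => //; rewrite neq_ltn irr.1 orbT.
Qed.

Lemma monic_irredX : monic_irred 'X.
Proof. by split; [rewrite -['X]subr0; exact: irredp_XsubC | exact: monicX]. Qed.

Lemma exists_monic_irred_dvdp p : (1 < size p)%N ->
  exists2 pi, monic_irred pi & pi %| p.
Proof.
move=> p1.
have ex : exists n, `[< exists q, [/\ (1 < size q)%N, q %| p & size q = n] >].
  by exists (size p); apply/asboolP; exists p.
case: (ex_minnP ex) => n /asboolP[q [q1 qp <-]] qmin.
have q0 : q != 0 by rewrite -size_poly_gt0 ltnW.
have irr : irreducible_poly q.
  split=> // r r1 rq; have r0 : r != 0 by apply: contraTneq rq => ->; rewrite dvd0p.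
  rewrite -dvdp_size_eqp // eqn_leq dvdp_leq //=; apply: qmin; apply/asboolP.
  exists r; split=> //; last exact: dvdp_trans qp.
  by rewrite ltn_neqAle eq_sym r1 size_poly_gt0.
have lc0 : (lead_coef q)^-1 != 0 by rewrite invr_eq0 lead_coef_eq0.
exists ((lead_coef q)^-1 *: q); last by rewrite dvdpZl.
split; last by rewrite monicE lead_coefZ mulVf // lead_coef_eq0.
split; first by rewrite size_scale.
by move=> r r1; rewrite dvdpZr // => /(irr.2 _ r1) h; apply: eqp_trans h _;
  rewrite eqp_sym eqp_scale.
Qed.

Lemma monic_irred_divisors_finite p : p != 0 ->
  exists s : seq {poly k}, forall pi, monic_irred pi -> pi %| p -> pi \in s.
Proof.
have [n] := ubnP (size p); elim: n p => // n IH p; rewrite ltnS => le p0.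
have [le1|lt1] := leqP (size p) 1.
  exists [::] => pi [irr _] /(dvdp_leq p0) h.
  by have := leq_trans (leq_trans irr.1 h) le1.
have [pi mi /dvdpP[q E]] := exists_monic_irred_dvdp lt1.
have q0 : q != 0 by apply: contraNneq p0 => q0; rewrite E q0 mul0r.
have [|s hs] := IH q _ q0.
  apply: leq_trans le; rewrite E size_mul // ?irredp_neq0 //; last exact: mi.1.
  by have [[h _] _] := mi; case: (size pi) h => [|[|m]] // _;
    rewrite !addnS /= ltnS leq_addr.
exists (pi :: s) => pi' mi'; rewrite E irredp_dvdM; last exact: mi'.1.
rewrite in_cons; case/orP=> [/(hs _ mi') ->|/monic_irred_eq ->] //;
  first by rewrite orbT.
by rewrite eqxx.
Qed.

Lemma separable_dvdp p q : separable_poly p ->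
  (forall pi, monic_irred pi -> pi %| p -> pi %| q) -> p %| q.
Proof.
have [n] := ubnP (size p); elim: n p => // n IH p; rewrite ltnS => le sp h.
have p0 := separable_poly_neq0 sp.
have [le1|lt1] := leqP (size p) 1.
  by have /eqP : size p = 1%N; [apply/eqP; rewrite eqn_leq le1 size_poly_gt0 |
    rewrite size_poly_eq1 => /eqp_dvdl ->; exact: dvd1p].
have [pi mi pip] := exists_monic_irred_dvdp lt1; have /dvdpP[r E] := pip.
have r0 : r != 0 by apply: contraNneq p0 => r0; rewrite E r0 mul0r.
move: sp; rewrite E separable_mul => /and3P[sr _ co].
rewrite Gauss_dvdp // (h pi) // andbT; apply: IH => //; last first.
  by move=> pi' mi' h'; apply: h => //; rewrite E dvdp_mulr.
apply: leq_trans le; rewrite E size_mul // ?irredp_neq0 //; last exact: mi.1.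
by have [[h1 _] _] := mi; case: (size pi) h1 => [|[|m]] // _;
  rewrite !addnS /= ltnS leq_addr.
Qed.

End Multiplicity.

(** * Irreducible factors in a Kummer tower *)

Section Kummer.
Variables (k : fieldType) (a : k) (m : nat).
Hypothesis char0 : forall n, n.+1%:R != 0 :> k.
Hypotheses (a0 : a != 0) (m0 : (0 < m)%N).
Implicit Types (p q r pi : {poly k}).

(** In a field where [t = a u^m], this is [t] as a polynomial in [u]; thus
    [p \Po s] is the element [p(t)] of [k[u]]. *)
Definition kummer : {poly k} := a *: 'X^m.
Local Notation s := kummer.

Lemma size_kummer : size s = m.+1.
Proof. by rewrite /s size_scale // size_polyXn. Qed.

Lemma comp_kummer_eq0 p : (p \Po s == 0) = (p == 0).
Proof. by apply: comp_poly_eq0; rewrite size_kummer ltnS. Qed.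

(** The powers of [s] modulo [pi] are linearly dependent. *)
Lemma exists_dvdp_comp pi : (1 < size pi)%N -> exists2 p, p != 0 & pi %| p \Po s.
Proof.
move=> pi1; set d := size pi; have pi0 : pi != 0 by rewrite -size_poly_gt0 ltnW.
pose B : 'M[k]_(d, d.-1) := \matrix_(i < d) poly_rV ((s ^+ i) %% pi).
have : kermx B != 0.
  rewrite kermx_eq0 /row_free; apply/negP => /eqP E.
  have := rank_leq_col B; rewrite E; have : (0 < d)%N by exact: ltnW.
  by case: (d) => // n _; rewrite /= ltnn.
case/rowV0Pn => v /sub_kermxP vB v0.
exists (rVpoly v); first by apply: contraNneq v0 => h; rewrite -[v]rVpolyK h linear0.
have -> : rVpoly v \Po s = \sum_(i < d) v 0 i *: s ^+ i.
  rewrite {1}/rVpoly poly_def raddf_sum /=.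
  by apply: eq_bigr => i _; rewrite comp_polyZ comp_Xn_poly valK.
rewrite /dvdp (big_morph (fun p => p %% pi) (modpD pi) (mod0p pi)); apply/eqP.
have : rVpoly (v *m B) = 0 by rewrite vB linear0.
rewrite mulmx_sum_row linear_sum /= => E; rewrite -[RHS]E.
apply: eq_bigr => i _; rewrite modpZl linearZ /= rowK poly_rV_K //.
by rewrite -ltnS prednK ?ltn_modp // ltnW.
Qed.

(** The two primes of [k[u]] contract to the same prime of [k[t]]. *)
Definition linked pi pi' := forall p, (pi %| p \Po s) = (pi' %| p \Po s).

Lemma linked_sym pi pi' : linked pi pi' -> linked pi' pi.
Proof. by move=> h p; rewrite h. Qed.

Section Over.
Variable pi : {poly k}.
Hypotheses (mi : monic_irred pi) (piX : pi <> 'X).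

(** The contraction of the prime [pi] is generated by an irreducible polynomial
    in [t], which is prime to [t] because [pi] is prime to [u]. *)
Lemma exists_irred_below : exists p, [/\ irreducible_poly p, pi %| p \Po s,
  (forall q, pi %| q \Po s -> p %| q) & p.[0] != 0].
Proof.
have ex : exists n, `[< exists p, [/\ p != 0, pi %| p \Po s & size p = n] >].
  have [p p0 h] := exists_dvdp_comp mi.1.1.
  by exists (size p); apply/asboolP; exists p.
case: (ex_minnP ex) => n /asboolP[p [p0 pip <-]] pmin {ex n}.
have gen q : pi %| q \Po s -> p %| q.
  move=> h; rewrite /dvdp; apply/negPn/negP => r0.
  have : (size p <= size (q %% p)%R)%N.
    apply: pmin; apply/asboolP; exists (q %% p); split=> //.
    have E : q %% p = q - q %/ p * p by rewrite {2}(polydiv.Pdiv.Field.divp_eq q p)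
      addrC addKr.
    by rewrite E rmorphB rmorphM /= dvdp_sub // dvdp_mull.
  by rewrite leqNgt ltn_modp p0.
have p1 : (1 < size p)%N.
  have := dvdp_leq _ pip; rewrite comp_kummer_eq0 => /(_ p0) h.
  rewrite ltnNge; apply/negP => le; have := leq_trans mi.1.1 h.
  by rewrite (size1_polyC le) comp_polyC ltnNge size_polyC leq_b1.
have irr : irreducible_poly p.
  split=> // q q1 /dvdpP[r E].
  have r0 : r != 0 by apply: contraNneq p0 => r0; rewrite E r0 mul0r.
  have q0 : q != 0 by apply: contraNneq p0 => q0; rewrite E q0 mulr0.
  have : pi %| (r \Po s) * (q \Po s) by rewrite -rmorphM -E.
  rewrite irredp_dvdM; last exact: mi.1.
  case/orP => /gen; last by move=> pq; rewrite /eqp pq E dvdp_mull.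
  move/(dvdp_leq r0); rewrite E size_mul // leqNgt => /negP lt.
  case: lt; have : (1 < size q)%N by rewrite ltn_neqAle eq_sym q1 size_poly_gt0.
  by case: (size q) => [|[|j]] // _; rewrite !addnS /= ltnS leq_addr.
exists p; split=> //; apply/negP => root0.
have : 'X %| p by rewrite -['X]subr0 dvdp_XsubCl.
move/(irr.2 'X); rewrite size_polyX => /(_ isT) eqX.
have : pi %| 'X \Po s by apply: dvdp_trans pip _; apply: dvdp_comp_poly; case/andP: eqX.
rewrite comp_polyX /s dvdpZr //; case: (m) => [|n].
  rewrite expr0 dvdp1 => /eqP h; have := mi.1.1; by rewrite h.
move=> h; apply: piX; apply: monic_irred_eq => //; first exact: monic_irredX.
have : pi %| 'X ^+ n.+1 by [].
elim: (n.+1) => [|j IH]; first by rewrite expr0 dvdp1 => /eqP h1; have := mi.1.1;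
  rewrite h1.
by rewrite exprS irredp_dvdM; [case/orP => // /IH | exact: mi.1].
Qed.

Definition below : {poly k} := xget 0 [set p | [/\ irreducible_poly p, pi %| p \Po s,
  (forall q, pi %| q \Po s -> p %| q) & p.[0] != 0]].

Lemma belowP : [/\ irreducible_poly below, pi %| below \Po s,
  (forall q, pi %| q \Po s -> below %| q) & below.[0] != 0].
Proof. by have [p hp] := exists_irred_below; exact: (@xgetI _ 0 [set p | _] p hp). Qed.

(** The pullback is unramified away from 0: the derivative of [p \Po s] is
    [(p' \Po s) * s'], and in characteristic 0 both factors are prime to
    [p \Po s], the second one because it is a monomial. *)
Lemma separable_below : separable_poly (below \Po s).
Proof.
have [irr _ _ b0] := belowP.
rewrite separable_poly.unlock deriv_comp coprimepMr; apply/andP; split.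
  apply: coprimep_comp_poly; rewrite irreducible_poly_coprime //.
  have bn0 := irredp_neq0 irr.
  apply/negP => h; have [d0|d0] := eqVneq below^`() 0.
    have := congr1 (fun p => p`_(size below).-2) d0.
    rewrite coef_deriv coef0; have /= := irr.1.
    have : lead_coef below != 0 by rewrite lead_coef_eq0.
    rewrite /lead_coef; case: (size below) => [|[|n]] //= lc0 _ /eqP.
    by rewrite -mulr_natr mulf_eq0 (negbTE lc0) (negbTE (char0 _)).
  by have := dvdp_leq d0 h; rewrite leqNgt lt_size_deriv.
rewrite /s derivZ derivXn coprimepZr // -scaler_nat coprimepZr; last first.
  by case: (m) m0.
apply: coprimep_expr; rewrite coprimepX rootE horner_comp.
by rewrite !hornerE expr0n; case: (m) m0 => //= n _; rewrite mulr0.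
Qed.

Lemma below_linked pi' : monic_irred pi' -> pi' %| below \Po s -> linked pi pi'.
Proof.
move=> mi' h q; have [irr hpi gen _] := belowP.
have [bq|nbq] := boolP (below %| q).
  have {}bq := dvdp_comp_poly s bq.
  by rewrite (dvdp_trans hpi bq) (dvdp_trans h bq).
have -> : (pi %| q \Po s) = false by apply: contraNF nbq; exact: gen.
apply/esym/negP => h'.
have : coprimep (below \Po s) (q \Po s).
  by apply: coprimep_comp_poly; rewrite irreducible_poly_coprime.
move/coprimepP => /(_ pi' h h'); rewrite -size_poly_eq1 => /eqP e.
by have := mi'.1.1; rewrite e.
Qed.

Lemma mult_below pi' : monic_irred pi' -> linked pi pi' -> mult pi' (below \Po s) = 1%N.
Proof.
move=> mi' lk; have sep := separable_below; have n0 := separable_poly_neq0 sep.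
have [_ hpi _ _] := belowP.
apply/eqP; rewrite eqn_leq -dvdp_exp_mult ?mi'.1.1 // expr1 -lk hpi andbT.
rewrite leqNgt -dvdp_exp_mult ?mi'.1.1 //; rewrite (separable_nosquare sep) //.
by rewrite neq_ltn mi'.1.1 orbT.
Qed.

(** By unramifiedness, the valuation at [pi] of an element of [k[t]] is its
    valuation at the prime below, hence the same for all primes above. *)
Lemma linked_mult pi' p : monic_irred pi' -> linked pi pi' -> p != 0 ->
  mult pi (p \Po s) = mult pi' (p \Po s).
Proof.
move=> mi' lk.
have [n] := ubnP (size p); elim: n p => // n IH p; rewrite ltnS => le p0.
have ps0 : p \Po s != 0 by rewrite comp_kummer_eq0.
have [h|nh] := boolP (pi %| p \Po s); last first.
  by apply/eqP; rewrite (eqP (_ : mult pi _ == 0%N)) ?mult_eq0 ?mi.1.1 //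
    eq_sym mult_eq0 ?mi'.1.1 // -lk.
have [irr _ gen _] := belowP; have /dvdpP[q E] := gen _ h.
have q0 : q != 0 by apply: contraNneq p0 => q0; rewrite E q0 mul0r.
have b0 := irredp_neq0 irr.
rewrite E rmorphM /= !multM ?comp_kummer_eq0 //; [|exact: mi'.1|exact: mi.1].
rewrite (mult_below mi' lk) (mult_below mi (fun=> erefl)) IH //.
apply: leq_trans le; rewrite E size_mul //.
by have := irr.1; case: (size below) => [|[|j]] // _; rewrite !addnS /= ltnS leq_addr.
Qed.

Lemma linked_finite : exists F : seq {poly k}, forall pi', monic_irred pi' ->
  linked pi pi' -> pi' \in F.
Proof.
have [_ hpi _ _] := belowP.
have [F hF] := monic_irred_divisors_finite (separable_poly_neq0 separable_below).
by exists F => pi' mi' lk; apply: hF => //; rewrite -lk.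
Qed.

End Over.
End Kummer.

(** * Valuations of a simple transcendental extension *)

Section Valuations.
Variables (k K : fieldType) (eps : {rmorphism k -> K}) (u : K).
Hypothesis transc : forall p : {poly k}, (map_poly eps p).[u] = 0 -> p = 0.
Implicit Types (p q r pi : {poly k}) (x y : K).

Definition ev p : K := (map_poly eps p).[u].

Lemma evD p q : ev (p + q) = ev p + ev q. Proof. by rewrite /ev rmorphD hornerD. Qed.
Lemma evN p : ev (- p) = - ev p. Proof. by rewrite /ev rmorphN hornerN. Qed.
Lemma evB p q : ev (p - q) = ev p - ev q. Proof. by rewrite evD evN. Qed.
Lemma evM p q : ev (p * q) = ev p * ev q. Proof. by rewrite /ev rmorphM hornerM. Qed.
Lemma evC c : ev c%:P = eps c. Proof. by rewrite /ev map_polyC hornerC. Qed.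
Lemma ev1 : ev 1 = 1. Proof. by rewrite evC rmorph1. Qed.
Lemma evX : ev 'X = u. Proof. by rewrite /ev map_polyX hornerX. Qed.
Lemma ev_eq0 p : (ev p == 0) = (p == 0).
Proof. by apply/eqP/eqP => [/transc|->] //; rewrite /ev rmorph0 horner0. Qed.
Lemma ev_inj p q : ev p = ev q -> p = q.
Proof. by move/eqP; rewrite -subr_eq0 -evB ev_eq0 subr_eq0 => /eqP. Qed.
Lemma u_neq0 : u != 0. Proof. by rewrite -evX ev_eq0 polyX_eq0. Qed.

(** The multiplicative group of [k(u)]. *)
Definition frac_unit x := exists p q, [/\ p != 0, q != 0 & x = ev p / ev q].

Lemma frac_unitM x y : frac_unit x -> frac_unit y -> frac_unit (x * y).
Proof.
move=> [p [q [p0 q0 ->]]] [r [s [r0 s0 ->]]]; exists (p * r), (q * s).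
by rewrite !mulf_neq0 // !evM mulf_div.
Qed.

Lemma frac_unitV x : frac_unit x -> frac_unit x^-1.
Proof. by move=> [p [q [p0 q0 ->]]]; exists q, p; rewrite invf_div. Qed.

Lemma frac_unit_ev p : p != 0 -> frac_unit (ev p).
Proof. by move=> p0; exists p, 1; rewrite oner_neq0 ev1 divr1. Qed.

Lemma frac_unit_expz x (j : int) : frac_unit x -> frac_unit (x ^ j).
Proof.
move=> ux; have key n : frac_unit (x ^+ n).
  elim: n => [|n IH]; last by rewrite exprS; exact: frac_unitM.
  by rewrite expr0 -ev1; apply: frac_unit_ev; exact: oner_neq0.
case: j => n; first exact: key.
by rewrite NegzE -invr_expz; apply: frac_unitV; exact: (key n.+1).
Qed.

Definition ord pi x : int := xget 0 [set n | exists p q,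
  [/\ p != 0, q != 0, x = ev p / ev q & n = (mult pi p)%:Z - (mult pi q)%:Z]].

Section OrdTheory.
Variable pi : {poly k}.
Hypothesis irr : irreducible_poly pi.

Lemma ordE p q : p != 0 -> q != 0 ->
  ord pi (ev p / ev q) = (mult pi p)%:Z - (mult pi q)%:Z.
Proof.
move=> p0 q0; apply: xget_unique; first by exists p, q.
move=> n [p' [q' [p'0 q'0 /eqP]]].
rewrite eqr_div ?ev_eq0 // -!evM => /eqP/ev_inj/(congr1 (mult pi)) E ->.
rewrite !multM // in E.
apply/eqP; rewrite subr_eq addrAC eq_sym subr_eq -!PoszD; apply/eqP; congr Posz.
by rewrite E addnC.
Qed.

Lemma ordM x y : frac_unit x -> frac_unit y -> ord pi (x * y) = ord pi x + ord pi y.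
Proof.
move=> [p [q [p0 q0 ->]]] [r [s [r0 s0 ->]]].
rewrite mulf_div -!evM !ordE ?mulf_neq0 // !multM // !PoszD opprD.
by rewrite addrACA.
Qed.

Lemma ordV x : frac_unit x -> ord pi x^-1 = - ord pi x.
Proof. by move=> [p [q [p0 q0 ->]]]; rewrite invf_div !ordE // opprB. Qed.

Lemma ord_ev p : p != 0 -> ord pi (ev p) = (mult pi p)%:Z.
Proof.
move=> p0; rewrite -[ev p]divr1 -ev1 ordE ?oner_neq0 //.
by rewrite (eqP (_ : mult pi 1 == 0%N)) ?subr0 // mult_eq0 ?irr.1 ?oner_neq0 // dvdp1;
  have := irr.1; case: (size pi) => [|[]].
Qed.

Lemma ord_expz x (j : int) : frac_unit x -> ord pi x = 0 -> ord pi (x ^ j) = 0.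
Proof.
move=> ux x0; have key n : ord pi (x ^+ n) = 0.
  elim: n => [|n IH]; last by rewrite exprS ordM ?IH ?x0 //; exact: (frac_unit_expz n).
  by rewrite expr0 -ev1 ord_ev ?oner_neq0 // (eqP (_ : mult pi 1 == 0%N)) //
    mult_eq0 ?irr.1 ?oner_neq0 // dvdp1;
  have := irr.1; case: (size pi) => [|[]].
case: j => n; first exact: key.
by rewrite NegzE -invr_expz ordV ?key ?oppr0 //; exact: (frac_unit_expz n.+1).
Qed.

Lemma ord_const c : c != 0 -> ord pi (eps c) = 0.
Proof.
move=> c0; rewrite -evC ord_ev ?polyC_eq0 //.
apply/eqP; rewrite eqz_nat mult_eq0 ?irr.1 ?polyC_eq0 //; apply/negP => /dvdp_leq.
by rewrite polyC_eq0 c0 size_polyC c0 leqNgt irr.1 => /(_ isT).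
Qed.

End OrdTheory.

Lemma ord_u pi : monic_irred pi -> pi <> 'X -> ord pi u = 0.
Proof.
move=> mi piX; rewrite -evX ord_ev ?polyX_eq0 //; last exact: mi.1.
apply/eqP; rewrite eqz_nat mult_eq0 ?mi.1.1 ?polyX_eq0 //; apply/negP => h.
by apply: piX; apply: monic_irred_eq => //; exact: monic_irredX.
Qed.

Lemma ord_finite x : frac_unit x ->
  exists F : seq {poly k}, forall pi, monic_irred pi -> ord pi x <> 0 -> pi \in F.
Proof.
move=> [p [q [p0 q0 ->]]].
have [Fp hp] := monic_irred_divisors_finite p0.
have [Fq hq] := monic_irred_divisors_finite q0.
exists (Fp ++ Fq) => pi mi; rewrite ordE //; last exact: mi.1.
rewrite mem_cat; have [/(hp _ mi) -> //|np] := boolP (pi %| p).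
have [/(hq _ mi) -> //|nq] := boolP (pi %| q); first by rewrite orbT.
rewrite (eqP (_ : mult pi p == 0%N)) ?mult_eq0 ?mi.1.1 //.
by rewrite (eqP (_ : mult pi q == 0%N)) ?mult_eq0 ?mi.1.1.
Qed.

(** Descent on the degrees of numerator and denominator: a zero of [x] outside
    0 forces a nonconstant polynomial [N] with value in [Y] to divide the
    numerator, and dividing by [N] stays in [Hs]. *)
Lemma frac_descent (Hs Y : set K) :
  (forall c, c != 0 -> Y (eps c)) -> Y u ->
  (forall x y, Y x -> Y y -> Y (x * y)) -> (forall x, Y x -> Y x^-1) ->
  (forall x, Hs x -> frac_unit x) -> (forall x, Hs x -> Hs x^-1) ->
  (forall x y, Hs x -> Y y -> frac_unit y -> Hs (x * y)) ->
  (forall x pi, Hs x -> monic_irred pi -> pi <> 'X -> 0 < ord pi x ->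
     exists N : {poly k}, [/\ (1 < size N)%N, Y (ev N) & forall p q, p != 0 -> q != 0 ->
       x = ev p / ev q -> coprimep p q -> N %| p]) ->
  forall x, Hs x -> Y x.
Proof.
move=> Yc Yu YM YV Hu HV HM Hdiv.
have claim p q : p != 0 -> q != 0 -> coprimep p q -> Hs (ev p / ev q) ->
  (1 < size p)%N ->
    exists N : {poly k}, [/\ (1 < size N)%N, Y (ev N) & N %| p].
  move=> p0 q0 co Hpq /exists_monic_irred_dvdp[pi mi pip].
  have [piX|piX] := pselect (pi = 'X).
    by exists 'X; rewrite size_polyX evX -piX.
  have nq : ~~ (pi %| q).
    apply/negP => piq; have := coprimepP _ _ co pi pip piq.
    by rewrite -size_poly_eq1 => /eqP e; have := mi.1.1; rewrite e.
  have [|N [N1 YN hN]] := Hdiv _ pi Hpq mi piX.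
    rewrite ordE //; last exact: mi.1.
    rewrite (eqP (_ : mult pi q == 0%N)) ?mult_eq0 ?mi.1.1 // subr0 ltz_nat lt0n.
    by rewrite mult_eq0 ?mi.1.1 // pip.
  by exists N; split=> //; apply: (hN p q).
have descent p (N : {poly k}) : p != 0 -> (1 < size N)%N -> N %| p ->
    exists r, [/\ r != 0, p = r * N, ev N != 0 & (size r < size p)%N].
  move=> p0 N1 /dvdpP[r E]; exists r.
  have r0 : r != 0 by apply: contraNneq p0 => r0; rewrite E r0 mul0r.
  have N0 : N != 0 by rewrite -size_poly_gt0 ltnW.
  rewrite ev_eq0; split=> //; rewrite E size_mul //.
  by case: (size N) N1 => [|[|j]] // _; rewrite !addnS /= ltnS leq_addr.
suff main n p q : (size p + size q < n)%N -> p != 0 -> q != 0 ->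
    Hs (ev p / ev q) -> Y (ev p / ev q).
  move=> x Hx; have [p [q [p0 q0 E]]] := Hu x Hx.
  by rewrite E; apply: (main (size p + size q).+1) => //; rewrite -E.
elim: n p q => // n IH p0 q0; rewrite ltnS => le p00 q00.
have [p [q [p0' q0' E co lepq]]] : exists p q, [/\ p != 0, q != 0,
    ev p0 / ev q0 = ev p / ev q, coprimep p q & (size p + size q <= n)%N].
  have g0 : gcdp p0 q0 != 0 by rewrite gcdp_eq0 negb_and p00.
  have co : coprimep (p0 %/ gcdp p0 q0) (q0 %/ gcdp p0 q0).
    by rewrite coprimep_div_gcd // p00.
  have pE := divpK (dvdp_gcdl p0 q0); have qE := divpK (dvdp_gcdr p0 q0).
  move: (gcdp p0 q0) g0 co pE qE => g g0.
  move: (p0 %/ g) (q0 %/ g) => p q co pE qE.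
  have p' : p != 0 by apply: contraNneq p00 => h; rewrite -pE h mul0r.
  have q' : q != 0 by apply: contraNneq q00 => h; rewrite -qE h mul0r.
  exists p, q; split=> //.
  - by rewrite -pE -qE !evM -mulf_div divff ?mulr1 // ev_eq0.
  - apply: leq_trans le; apply: leq_add.
      by rewrite dvdp_leq // -pE dvdp_mulr.
    by rewrite dvdp_leq // -qE dvdp_mulr.
rewrite E => Hpq; have Hu_pq := Hu _ Hpq.
have [p1|p1] := ltnP 1 (size p).
  have [N [N1 YN /(descent p N p0' N1)[r [r0 pE eN0 lt]]]] := claim p q p0' q0' co
    Hpq p1.
  have E' : ev p / ev q = ev r / ev q * ev N by rewrite pE evM mulrAC.
  rewrite E'; apply: YM => //; apply: IH => //.
    by apply: leq_trans lepq; rewrite -addSn leq_add2r.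
  have -> : ev r / ev q = ev p / ev q * (ev N)^-1 by rewrite E' mulfK.
  by apply: HM => //; [exact: YV | apply/frac_unitV/frac_unit_ev; rewrite -ev_eq0].
have [q1|q1] := ltnP 1 (size q).
  rewrite -[_ / _]invrK invf_div; apply: (YV).
  have Hqp : Hs (ev q / ev p) by rewrite -invf_div; exact: HV.
  rewrite coprimep_sym in co.
  have [N [N1 YN /(descent q N q0' N1)[r [r0 qE eN0 lt]]]] := claim q p q0' p0' co
    Hqp q1.
  have E' : ev q / ev p = ev r / ev p * ev N by rewrite qE evM mulrAC.
  rewrite E'; apply: YM => //; apply: IH => //.
    by apply: leq_trans lepq; rewrite addnC -addnS leq_add2l.
  have -> : ev r / ev p = ev q / ev p * (ev N)^-1 by rewrite E' mulfK.
  by apply: HM => //; [exact: YV | apply/frac_unitV/frac_unit_ev; rewrite -ev_eq0].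
rewrite (size1_polyC p1) (size1_polyC q1) !evC; apply: YM; last apply: YV.
  by apply: Yc; rewrite -polyC_eq0 -(size1_polyC p1).
by apply: Yc; rewrite -polyC_eq0 -(size1_polyC q1).
Qed.

(** The multiplicative group of [k(u)] modulo constants and powers of [u] is
    the group of divisors prime to 0. *)
Lemma frac_ord0 x : frac_unit x ->
  (forall pi, monic_irred pi -> pi <> 'X -> ord pi x = 0) ->
  exists c (j : int), c != 0 /\ x = eps c * u ^ j.
Proof.
move=> ux ox.
apply: (frac_descent
  (Hs := [set x | frac_unit x /\ forall pi, monic_irred pi -> pi <> 'X -> ord pi x = 0])
  (Y := [set x | exists c (j : int), c != 0 /\ x = eps c * u ^ j])) => //.
- by move=> c c0; exists c, 0; rewrite expr0z mulr1.
- by exists 1, 1; rewrite oner_neq0 rmorph1 mul1r expr1z.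
- move=> _ _ [c [i [c0 ->]]] [d [j [d0 ->]]]; exists (c * d), (i + j).
  by rewrite mulf_neq0 // rmorphM mulrACA expfzDr // u_neq0.
- move=> _ [c [i [c0 ->]]]; exists c^-1, (- i).
  by rewrite invr_eq0 c0 invfM fmorphV invr_expz.
- by move=> y [].
- move=> y [uy oy]; split; first exact: frac_unitV.
  by move=> pi mi piX; rewrite ordV ?oy ?oppr0 //; exact: mi.1.
- move=> y _ [uy oy] [c [j [c0 ->]]] uz; split; first exact: frac_unitM.
  move=> pi mi piX; rewrite ordM //; last exact: mi.1.
  have uu : frac_unit u by rewrite -evX; apply: frac_unit_ev; rewrite polyX_eq0.
  have uc : frac_unit (eps c) by rewrite -evC; apply: frac_unit_ev; rewrite polyC_eq0.
  rewrite oy // ordM //; [|exact: mi.1 | exact: frac_unit_expz].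
  by rewrite ord_const ?ord_expz ?ord_u ?addr0 //; exact: mi.1.
- by move=> y pi [_ oy] mi piX; rewrite oy.
Qed.

Section KummerStep.
Variables (a : k) (m : nat).
Hypothesis char0 : forall n, n.+1%:R != 0 :> k.
Hypotheses (a0 : a != 0) (m0 : (0 < m)%N).
Local Notation s := (kummer a m).

(** The subgroup of [k(u)^*] generated by [k(t)^*] and [u], where [t = s(u)]. *)
Definition sub_frac x := exists p q (j : int), [/\ p != 0, q != 0 &
  x = ev (p \Po s) / ev (q \Po s) * u ^ j].

Lemma sub_frac_ord x pi pi' : sub_frac x -> monic_irred pi -> pi <> 'X ->
  monic_irred pi' -> pi' <> 'X -> linked a m pi pi' -> ord pi x = ord pi' x.
Proof.
move=> [p [q [j [p0 q0 ->]]]] mi piX mi' pi'X lk.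
have uu : frac_unit u by rewrite -evX; apply: frac_unit_ev; rewrite polyX_eq0.
have uj := frac_unit_expz j uu.
have ps0 : p \Po s != 0 by rewrite comp_kummer_eq0.
have qs0 : q \Po s != 0 by rewrite comp_kummer_eq0.
have uy : frac_unit (ev (p \Po s) / ev (q \Po s)) by exists (p \Po s), (q \Po s).
have [irr irr'] := (mi.1, mi'.1).
rewrite (ordM irr uy uj) (ordM irr' uy uj) !ord_expz ?ord_u // !ordE //.
by rewrite !(linked_mult char0 a0 m0 mi piX mi' lk).
Qed.

(** If [pi] divides the numerator of [x], then so do all primes linked to [pi],
    hence so does their product, which up to a constant is an element of
    [k[t]]: it can be divided out. *)
Lemma frac_linked x : frac_unit x ->
  (forall pi pi', monic_irred pi -> pi <> 'X -> monic_irred pi' -> pi' <> 'X ->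
     linked a m pi pi' -> ord pi x = ord pi' x) ->
  sub_frac x.
Proof.
move=> ux ox.
apply: (frac_descent (Y := sub_frac)
  (Hs := [set x | frac_unit x /\ forall pi pi', monic_irred pi -> pi <> 'X ->
     monic_irred pi' -> pi' <> 'X -> linked a m pi pi' -> ord pi x = ord pi' x])) => //.
- move=> c c0; exists c%:P, 1, 0; rewrite polyC_eq0 oner_neq0; split=> //.
  by rewrite !comp_polyC !evC rmorph1 divr1 expr0z mulr1.
- exists 1, 1, 1; rewrite oner_neq0; split=> //.
  by rewrite comp_polyC evC rmorph1 divr1 mul1r expr1z.
- move=> _ _ [p [q [i [p0 q0 ->]]]] [p' [q' [j [p'0 q'0 ->]]]].
  exists (p * p'), (q * q'), (i + j); rewrite !mulf_neq0 //; split=> //.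
  by rewrite !rmorphM /= !evM expfzDr ?u_neq0 // -mulf_div mulrACA.
- move=> _ [p [q [i [p0 q0 ->]]]]; exists q, p, (- i); split=> //.
  by rewrite invfM invf_div invr_expz.
- by move=> y [].
- move=> y [uy oy]; split; first exact: frac_unitV.
  move=> pi pi' mi piX mi' pi'X lk; have [irr irr'] := (mi.1, mi'.1).
  by rewrite !ordV // (oy pi pi').
- move=> y z [uy oy] Yz uz; split; first exact: frac_unitM.
  move=> pi pi' mi piX mi' pi'X lk; have [irr irr'] := (mi.1, mi'.1).
  by rewrite !ordM // (oy pi pi') // (sub_frac_ord Yz mi piX mi' pi'X lk).
move=> y pi [_ oy] mi piX opi; have [irr hpi _ b0] := belowP a0 m0 mi piX.
have n0 : below a m pi \Po s != 0 by rewrite comp_kummer_eq0 // irredp_neq0.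
exists (below a m pi \Po s); split.
- by apply: leq_trans (dvdp_leq n0 hpi); exact: mi.1.1.
- exists (below a m pi), 1, 0; rewrite irredp_neq0 // oner_neq0; split=> //.
  by rewrite comp_polyC evC rmorph1 divr1 expr0z mulr1.
move=> p q p0 q0 E co; apply: separable_dvdp; first exact: separable_below.
move=> pi' mi' h; have lk := below_linked a0 m0 mi piX mi' h.
have pi'X : pi' <> 'X.
  move=> e; move: h; rewrite e -['X]subr0 dvdp_XsubCl rootE horner_comp.
  have -> : s.[0] = 0 by rewrite /kummer !hornerE expr0n; case: (m) m0 => //= j _;
    rewrite mulr0.
  by rewrite (negbTE b0).
move: opi; rewrite (oy pi pi') // E ordE //; last exact: mi'.1.
apply: contraTT => np; rewrite (eqP (_ : mult pi' p == 0%N)) ?mult_eq0 ?mi'.1.1 //.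
by rewrite sub0r oppr_gt0 ltNge.
Qed.

End KummerStep.
End Valuations.

(** * Fields presented by a group of units *)

(** [K] is the fraction field of the rational group algebra of [G], with [chi g]
    as the monomial of exponent [g]. *)
Record presentation (G : zmodType) (K : fieldType) (rho : {rmorphism rat -> K})
    (chi : G -> K) : Prop := Presentation {
  pres0 : chi 0 = 1;
  presD : forall g h, chi (g + h) = chi g * chi h;
  pres_inj : forall p : {malg rat[G]}, mmap rho chi p = 0 -> p = 0;
  pres_frac : forall x, exists p q : {malg rat[G]},
    mmap rho chi q != 0 /\ x = mmap rho chi p / mmap rho chi q
}.

Section Characters.
Variables (G : zmodType) (K : fieldType) (chi : G -> K).
Hypothesis chi0 : chi 0 = 1.
Hypothesis chiD : forall g h, chi (g + h) = chi g * chi h.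

Lemma char_neq0 g : chi g != 0.
Proof.
apply/negP => /eqP g0; have := chiD g (- g).
by rewrite subrr chi0 g0 mul0r => /eqP; rewrite oner_eq0.
Qed.

Lemma charN g : chi (- g) = (chi g)^-1.
Proof.
by apply: (mulfI (char_neq0 g)); rewrite -chiD subrr chi0 divff // char_neq0.
Qed.

Lemma charB g h : chi (g - h) = chi g / chi h.
Proof. by rewrite chiD charN. Qed.

Lemma charMz g (z : int) : chi (g *~ z) = chi g ^ z.
Proof.
have key n : chi (g *+ n) = chi g ^+ n.
  by elim: n => [|n IH]; rewrite ?mulr0n ?expr0 // mulrS chiD IH exprS.
by case: z => n; [exact: key | rewrite NegzE mulrNz -pmulrn charN key -invr_expz].
Qed.

End Characters.

Section FieldOf.
Variables (H : zmodType) (K : fieldType) (rho : {rmorphism rat -> K}) (psi : H -> K).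
Hypothesis psi0 : psi 0 = 1.
Hypothesis psiD : forall g h, psi (g + h) = psi g * psi h.
Implicit Types (p q r : {malg rat[H]}) (g h u : H) (x y : K) (Q : set H).

Local Notation gev := (mmap rho psi).

Lemma gevU c h : gev << c *g h >> = rho c * psi h.
Proof. by rewrite mmapU. Qed.

Definition shift p u : {malg rat[H]} := \sum_(g <- msupp p) << p@_g *g g + u >>.

Lemma gev_shift p u : gev (shift p u) = gev p * psi u.
Proof.
rewrite raddf_sum mmapE mulr_suml; apply: eq_bigr => g _ /=.
by rewrite gevU psiD mulrA.
Qed.

Lemma mcoeff_shift p u h : (shift p u)@_h = p@_(h - u).
Proof.
rewrite raddf_sum /= (eq_bigr (fun g => p@_g *+ (g == h - u))); last first.
  by move=> g _; rewrite mcoeffU -subr_eq opprK.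
rewrite [in RHS](monalgE p) raddf_sum /=; apply: eq_bigr => g _.
by rewrite mcoeffU.
Qed.

Definition gmul p q : {malg rat[H]} := \sum_(g <- msupp p) p@_g *: shift q g.

Lemma supp_gmul Q p q : is_subgroup Q -> supp_in Q p -> supp_in Q q ->
  supp_in Q (gmul p q).
Proof.
move=> sQ pQ qQ; rewrite /gmul big_seq_cond; apply: (big_ind (@supp_in _ _ Q)).
- exact: supp_in0.
- exact: supp_inD.
move=> g /andP[/pQ Qg _] h; rewrite -mcoeff_neq0 mcoeffZ mulf_eq0 negb_or => /andP[_].
rewrite mcoeff_shift mcoeff_neq0 => /qQ Qhg.
by rewrite -(subrK g h); apply: subgroupD.
Qed.

Lemma mmap_scale (phi : H -> K) c r : mmap rho phi (c *: r) = rho c * mmap rho phi r.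
Proof.
rewrite [in LHS](monalgE r) scaler_sumr raddf_sum mmapE mulr_sumr /=.
apply: eq_bigr => h _; rewrite mulrA -rmorphM -(mmapU (f := rho)); congr mmap.
by apply/malgP => h'; rewrite mcoeffZ !mcoeffU mulrnAr.
Qed.

Lemma gev_gmul p q : gev (gmul p q) = gev p * gev q.
Proof.
rewrite raddf_sum [in RHS]mmapE mulr_suml; apply: eq_bigr => g _ /=.
by rewrite mmap_scale gev_shift mulrA mulrAC.
Qed.

Lemma gevM Q p q : is_subgroup Q -> supp_in Q p -> supp_in Q q ->
  exists2 r, supp_in Q r & gev r = gev p * gev q.
Proof. by exists (gmul p q); [exact: supp_gmul | exact: gev_gmul]. Qed.

(** The subfield generated by the units [psi h] with [h] in [Q]; numerator and
    denominator have their exponents in [Q], which is the form on which linear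
    independence of the units can act. *)
Definition fieldOf Q : set K := fun x =>
  exists p q, [/\ supp_in Q p, supp_in Q q, gev q != 0 & x = gev p / gev q].

Lemma fieldOf_const Q c : is_subgroup Q -> fieldOf Q (rho c).
Proof.
move=> [Q0 _]; exists << c *g 0 >>, << 1 *g 0 >>.
by rewrite !gevU psi0 rmorph1 !mulr1 oner_neq0 divr1; split=> //; exact: supp_inU.
Qed.

Lemma fieldOf_psi Q h : is_subgroup Q -> Q h -> fieldOf Q (psi h).
Proof.
move=> [Q0 _] Qh; exists << 1 *g h >>, << 1 *g 0 >>.
by rewrite !gevU psi0 rmorph1 mulr1 mul1r oner_neq0 divr1; split=> //; exact: supp_inU.
Qed.

Lemma fieldOf_divring Q : is_subgroup Q ->
  GRing.divring_closed ([pred x | `[< fieldOf Q x >]] : {pred K}).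
Proof.
move=> sQ; split.
- by apply/asboolP; rewrite -(rmorph1 rho); exact: fieldOf_const.
- move=> _ _ /asboolP[p [q [pQ qQ q0 ->]]] /asboolP[p' [q' [p'Q q'Q q'0 ->]]].
  have [r1 r1Q E1] := gevM sQ pQ q'Q; have [r2 r2Q E2] := gevM sQ p'Q qQ.
  have [r3 r3Q E3] := gevM sQ qQ q'Q.
  apply/asboolP; exists (r1 - r2), r3; split=> //; first exact: supp_inB.
    by rewrite E3 mulf_neq0.
  by rewrite raddfB /= E1 E2 E3 -mulNr addf_div // mulNr.
- move=> _ _ /asboolP[p [q [pQ qQ q0 ->]]] /asboolP[p' [q' [p'Q q'Q q'0 ->]]].
  have [->|p'0] := eqVneq (gev p') 0.
    by apply/asboolP; rewrite mul0r invr0 mulr0 -(rmorph0 rho); exact: fieldOf_const.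
  have [r1 r1Q E1] := gevM sQ pQ q'Q; have [r2 r2Q E2] := gevM sQ qQ p'Q.
  apply/asboolP; exists r1, r2; split=> //; first by rewrite E2 mulf_neq0.
  by rewrite E1 E2 invf_div mulf_div.
Qed.

Lemma fieldOf_div Q x y : is_subgroup Q -> fieldOf Q x -> fieldOf Q y ->
  fieldOf Q (x / y).
Proof.
move=> sQ Fx Fy; have [_ _ D] := fieldOf_divring sQ.
by apply/asboolP; apply: (D); apply/asboolP.
Qed.

Lemma fieldOf1 Q : is_subgroup Q -> fieldOf Q 1.
Proof. by move=> sQ; rewrite -(rmorph1 rho); exact: fieldOf_const. Qed.

Lemma fieldOfV Q x : is_subgroup Q -> fieldOf Q x -> fieldOf Q x^-1.
Proof. by move=> sQ Fx; rewrite -[_^-1]mul1r; apply: fieldOf_div => //;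
  exact: fieldOf1. Qed.

Lemma fieldOfM Q x y : is_subgroup Q -> fieldOf Q x -> fieldOf Q y -> fieldOf Q (x * y).
Proof.
by move=> sQ Fx Fy; rewrite -[y]invrK; apply: fieldOf_div => //; exact: fieldOfV.
Qed.

Lemma fieldOf_min Q (S : {pred K}) : GRing.divring_closed S ->
  (forall c, rho c \in S) -> (forall h, Q h -> psi h \in S) ->
  forall x, fieldOf Q x -> x \in S.
Proof.
move=> [S1 SB SD] Sc Sp x [p [q [pQ qQ _ ->]]].
have S0 : 0 \in S by rewrite -(subrr 1); apply: (SB).
have SV y : y \in S -> y^-1 \in S by rewrite -[y^-1]mul1r; exact: SD.
have SM y z : y \in S -> z \in S -> y * z \in S.
  by move=> Sy Sz; rewrite -[z]invrK; apply: (SD) => //; exact: SV.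
have SA y z : y \in S -> z \in S -> y + z \in S.
  by move=> Sy Sz; rewrite -[z]opprK; apply: (SB) => //; rewrite -sub0r; apply: (SB).
have Sg r : supp_in Q r -> gev r \in S.
  move=> rQ; rewrite mmapE big_seq_cond; apply: (big_ind (fun z => z \in S)) => //.
  by move=> h /andP[/rQ Qh _]; apply: (SM); [exact: Sc | exact: Sp].
by apply: (SD); exact: Sg.
Qed.

Lemma fieldOf_mono Q Q' : Q `<=` Q' -> fieldOf Q `<=` fieldOf Q'.
Proof.
move=> QQ' x [p [q [pQ qQ q0 ->]]]; exists p, q.
by split=> //; [exact: supp_inW pQ | exact: supp_inW qQ].
Qed.

Lemma fieldOf_bigcup (F : set (set H)) : F !=set0 -> total_on F subset ->
  fieldOf (\bigcup_(Q in F) Q) `<=` \bigcup_(Q in F) fieldOf Q.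
Proof.
move=> [Q0 FQ0] Ftot x [p [q [pF qF q0 ->]]].
have key r : supp_in (\bigcup_(Q in F) Q) r -> exists2 Q, F Q & supp_in Q r.
  move=> rF; suff h (s : seq H) : (forall g, g \in s -> (\bigcup_(Q in F) Q) g) ->
      exists2 Q, F Q & forall g, g \in s -> Q g.
    by have [Q] := h (msupp r) rF; exists Q.
  elim: s => [|g s IH] h; first by exists Q0.
  have [|Q FQ hQ] := IH; first by move=> g' g's; apply: h; rewrite in_cons g's orbT.
  have [Q' FQ' Q'g] := h g (mem_head _ _).
  case: (Ftot Q Q' FQ FQ') => QQ'.
    by exists Q' => // k; rewrite in_cons => /orP[/eqP -> //|/hQ]; exact: QQ'.
  by exists Q => // k; rewrite in_cons => /orP[/eqP ->|/hQ //]; exact: QQ'.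
have [Q FQ pQ] := key p pF; have [Q' FQ' qQ'] := key q qF.
case: (Ftot Q Q' FQ FQ') => QQ'.
  by exists Q' => //; exists p, q; split=> //; exact: supp_inW pQ.
by exists Q => //; exists p, q; split=> //; exact: supp_inW qQ'.
Qed.

Lemma fieldOf0 x : fieldOf [set 0] x -> exists c, x = rho c.
Proof.
move=> [p [q [p0 q0 _ ->]]].
have key r : supp_in [set 0] r -> gev r = rho r@_0.
  move=> r0; have {1}-> : r = << r@_0 *g 0 >>; last by rewrite gevU psi0 mulr1.
  apply/malgP => g; rewrite mcoeffU; case: eqP => [<- //|g0].
  by apply: mcoeff_outdom; apply/negP => /r0 /esym.
by exists (p@_0 / q@_0); rewrite !key // fmorph_div.
Qed.

(** The elements of [fieldOf Q] as a field of its own, over which polynomials can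
    be factored. *)
Definition subfield Q : fieldType := adjoin rho (fun h : set_type Q => psi (val h)).

Definition incl Q : {rmorphism subfield Q -> K} := \val.

Lemma subfieldP Q x : is_subgroup Q -> fieldOf Q x <-> exists c : subfield Q,
  incl Q c = x.
Proof.
move=> sQ; split.
  move=> Fx.
  have xA : x \in adjoin_pred rho (fun h : set_type Q => psi (val h)).
    apply/asboolP => S cS Sc Sp; apply: (fieldOf_min cS Sc) Fx => h Qh.
    exact: (Sp (SigSub (mem_set Qh))).
  by exists (Adjoin xA).
move=> [c <-]; have /asboolP /(_ [pred x | `[< fieldOf Q x >]]) h := valP c.
 apply/asboolP; apply: h; first exact: fieldOf_divring.
- by move=> d; apply/asboolP; exact: fieldOf_const.
- by move=> g; apply/asboolP; apply: fieldOf_psi => //; apply: set_mem; exact: (valP g).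
Qed.

Lemma subfield_char0 Q n : n.+1%:R != 0 :> subfield Q.
Proof.
apply/eqP => /(congr1 (incl Q)); rewrite rmorph0 rmorph_nat => /eqP.
by rewrite -(rmorph_nat rho) fmorph_eq0 pnatr_eq0.
Qed.

Lemma common_denominator Q n (f : nat -> K) : is_subgroup Q ->
  (forall i, fieldOf Q (f i)) ->
  exists2 q, gev q != 0 & forall i, (i < n)%N ->
    exists2 p, supp_in Q p & f i = gev p / gev q.
Proof.
move=> sQ Ff.
suff [q [_ q0 hq]] : exists q, [/\ supp_in Q q, gev q != 0 & forall i, (i < n)%N ->
    exists2 p, supp_in Q p & f i = gev p / gev q] by exists q.
elim: n => [|n [q [qQ q0 IH]]].
  exists << 1 *g 0 >>; split=> //; first by apply: supp_inU; case: sQ.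
  by rewrite gevU rmorph1 psi0 mulr1 oner_neq0.
have [p [r [pQ rQ r0 E]]] := Ff n.
have [s sQ' Es] := gevM sQ qQ rQ; have s0 : gev s != 0 by rewrite Es mulf_neq0.
exists s; split=> // i; rewrite ltnS leq_eqVlt => /orP[/eqP ->|/IH[p' p'Q E']].
  have [t tQ Et] := gevM sQ pQ qQ; exists t => //.
  by rewrite Et Es E [gev q * gev r]mulrC -mulf_div divff // mulr1.
have [t tQ Et] := gevM sQ p'Q rQ; exists t => //.
by rewrite Et Es E' -mulf_div divff // mulr1.
Qed.

End FieldOf.

Section Presented.
Variables (H : zmodType) (K : fieldType) (rho : {rmorphism rat -> K}) (psi : H -> K).
Hypothesis pres : presentation rho psi.
Implicit Types (p q r : {malg rat[H]}) (g h u : H) (x y : K) (Q : set H).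

Local Notation gev := (mmap rho psi).
Local Notation fieldOf := (fieldOf rho psi).
Local Notation subfield := (subfield rho psi).
Local Notation incl := (incl rho psi).
Let psi0 := pres0 pres.
Let psiD := presD pres.

(** Writing [psi h * gev q = gev p] with [p], [q] supported in [Q] forces
    [p] to be the translate of [q] by [h]. *)
Lemma fieldOf_psiP Q h : is_subgroup Q -> fieldOf Q (psi h) -> Q h.
Proof.
move=> sQ [p [q [pQ qQ q0 E]]].
have Epq : shift q h = p.
  apply/eqP; rewrite -subr_eq0; apply/eqP/(pres_inj pres).
  by rewrite raddfB /= (gev_shift rho psiD) E mulrC divfK // subrr.
have [g gq] : exists g, g \in msupp q.
  apply: contrapT => h0; move: q0; suff -> : q = 0 by rewrite raddf0 eqxx.
  apply/malgP => g; rewrite mcoeff0; apply: mcoeff_outdom.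
  by apply/negP => gq; apply: h0; exists g.
have Qg := qQ g gq; rewrite -(addrK g h); apply: sQ.2 => //; apply: pQ.
by rewrite -Epq -mcoeff_neq0 mcoeff_shift addrAC subrr add0r mcoeff_neq0.
Qed.


Lemma fieldOfT x : fieldOf setT x.
Proof. by have [p [q [q0 E]]] := pres_frac pres x; exists p, q. Qed.


(** After clearing denominators, a polynomial relation is a sum of translates
    by the multiples of [u] of elements supported in [Q]; their supports lie in
    different cosets of [Q]. *)
Lemma psi_transcendental Q u : is_subgroup Q -> (forall z : int, Q (u *~ z) -> z = 0) ->
  forall p : {poly subfield Q}, (map_poly (incl Q) p).[psi u] = 0 -> p = 0.
Proof.
move=> sQ uQ p; rewrite horner_poly => E.
have Ff i : fieldOf Q (incl Q p`_i) by apply/(subfieldP rho psi0 psiD) => //;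
  exists p`_i.
have [q q0 hq] := common_denominator psi0 psiD (size p) sQ Ff.
have [a ha] : exists a : 'I_(size p) -> {malg rat[H]}, forall i : 'I_(size p),
    supp_in Q (a i) /\ incl Q p`_i = gev (a i) / gev q.
  have h (i : 'I_(size p)) : exists a, supp_in Q a /\ incl Q p`_i = gev a / gev q.
    by have [a] := hq i (ltn_ord i); exists a.
  by have [a] := choice h; exists a.
have sum0 : \sum_(i < size p) shift (a i) (u *+ i) = 0.
  apply: (pres_inj pres); rewrite raddf_sum /=.
  have -> : \sum_(i < size p) gev (shift (a i) (u *+ i)) =
      (\sum_(i < size p) incl Q p`_i * psi u ^+ i) * gev q.
    rewrite mulr_suml; apply: eq_bigr => i _.
    by rewrite (gev_shift rho psiD) (ha i).2 [u *+ i]pmulrn (charMz psi0 psiD) mulrAC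
      divfK.
  by rewrite E mul0r.
apply/polyP => i; rewrite coef0.
have [lt|ge] := ltnP i (size p); last exact: nth_default.
pose j := Ordinal lt.
suff aj0 : a j = 0.
  apply/eqP; rewrite -(fmorph_eq0 (incl Q)) (ha j).2 aj0 raddf0 mul0r //.
apply/malgP => h; rewrite mcoeff0.
have [hj|/mcoeff_outdom //] := boolP (h \in msupp (a j)).
have := congr1 (mcoeff (h + u *+ j)) sum0; rewrite mcoeff0 raddf_sum /= (bigD1 j) //=.
rewrite mcoeff_shift addrK big1 ?addr0 // => i' ne; rewrite mcoeff_shift.
apply: mcoeff_outdom; apply/negP => /(ha i').1 Qi'.
have : Q (u *~ (j%:Z - i'%:Z)).
  have -> : u *~ (j%:Z - i'%:Z) = (h + u *+ j - u *+ i') - h.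
    by rewrite mulrzBr -!pmulrn [RHS]addrAC [h + _]addrC addrK.
  by apply: sQ.2 => //; exact: (ha j).1.
move/uQ/eqP; rewrite subr_eq0 eqz_nat => /eqP e.
by move: ne; rewrite -val_eqE /= -e eqxx.
Qed.

Definition addZ Q u : set H := [set h | exists z : int, Q (h - u *~ z)].

Lemma addZ_subgroup Q u : is_subgroup Q -> is_subgroup (addZ Q u).
Proof.
move=> sQ; split; first by exists 0; rewrite mulr0z subr0; case: sQ.
move=> h h' [z Qz] [z' Qz']; exists (z - z').
by rewrite mulrzBr opprD opprK addrACA -[- h' + _]opprK opprD opprK; apply: sQ.2.
Qed.

Lemma addZ_sub Q u : Q `<=` addZ Q u.
Proof. by move=> h Qh; exists 0; rewrite mulr0z subr0. Qed.

Section SimpleExtension.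
Variables (Q : set H) (u : H).
Hypotheses (sQ : is_subgroup Q) (uQ : forall z : int, Q (u *~ z) -> z = 0).
Let transc := psi_transcendental sQ uQ.
Local Notation eps := (incl Q).

Lemma fieldOf_addZ_ev (p : {poly subfield Q}) : fieldOf (addZ Q u) (ev eps (psi u) p).
Proof.
have sQ' := addZ_subgroup u sQ; have [F1 FB _] := fieldOf_divring rho psi0 psiD sQ'.
have FA x y : fieldOf (addZ Q u) x -> fieldOf (addZ Q u) y ->
  fieldOf (addZ Q u) (x + y).
  move=> Fx Fy; apply/asboolP; rewrite -[y]opprK; apply: (FB); first exact/asboolP.
  by rewrite -sub0r; apply: (FB); apply/asboolP => //; rewrite -(rmorph0 rho);
    exact: fieldOf_const.
rewrite /ev horner_poly; elim/big_ind: _ => [||i _] //.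
  by rewrite -(rmorph0 rho); exact: fieldOf_const.
apply: fieldOfM => //.
  by apply: (@fieldOf_mono _ _ rho psi _ _ (@addZ_sub Q u));
    apply/(subfieldP rho psi0 psiD) => //; exists p`_i.
rewrite -[_ ^+ i]/(_ ^ (Posz i)) -(charMz psi0 psiD); apply: fieldOf_psi => //.
by exists i; rewrite subrr; case: sQ.
Qed.

Lemma fieldOf_frac_unit x : x != 0 -> fieldOf (addZ Q u) x -> frac_unit eps (psi u) x.
Proof.
move=> x0 Fx.
pose S : {pred K} := [pred x | (x == 0) || `[< frac_unit eps (psi u) x >]].
have uu : frac_unit eps (psi u) (psi u).
  by rewrite -{2}(evX eps (psi u)); apply: frac_unit_ev => //; rewrite polyX_eq0.
have uc (c : subfield Q) : c != 0 -> frac_unit eps (psi u) (eps c).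
  by move=> c0; rewrite -(evC eps (psi u)); apply: frac_unit_ev => //;
    rewrite polyC_eq0.
have cS : GRing.divring_closed S.
  split.
  - apply/orP; right; apply/asboolP; rewrite -(rmorph1 eps); apply: (uc).
    exact: oner_neq0.
  - move=> y z /orP[/eqP ->|/asboolP uy] /orP[/eqP ->|/asboolP uz].
    + by rewrite subrr inE eqxx.
    + rewrite sub0r; apply/orP; right; apply/asboolP.
      by rewrite -mulN1r -(rmorphN1 eps); apply: frac_unitM => //; apply: (uc);
        rewrite oppr_eq0 oner_eq0.
    + by rewrite subr0; apply/orP; right; apply/asboolP.
    + move: uy uz => [p [q [p0 q0 ->]]] [p' [q' [p'0 q'0 ->]]].
      have e0 (r : {poly subfield Q}) : r != 0 ->
        ev eps (psi u) r != 0 by rewrite ev_eq0.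
      rewrite -mulNr addf_div ?e0 // mulNr -!evM -evB.
      have [->|ne] := eqVneq (p * q' - p' * q) 0.
        by rewrite /ev rmorph0 horner0 mul0r inE eqxx.
      apply/orP; right; apply/asboolP.
      by exists (p * q' - p' * q), (q * q'); rewrite mulf_neq0.
  - move=> y z /orP[/eqP ->|/asboolP uy] /orP[/eqP ->|/asboolP uz];
      rewrite ?mul0r ?invr0 ?mulr0 ?inE ?eqxx //.
    apply/orP; right; apply/asboolP; apply: frac_unitM => //; exact: frac_unitV.
have : x \in S.
  apply: (fieldOf_min cS) Fx => [c|h [z Qz]].
    have [->|c0] := eqVneq c 0; first by rewrite rmorph0 inE eqxx.
    apply/orP; right; apply/asboolP.
    have [d dE] := (subfieldP rho psi0 psiD (rho c) sQ).1 (fieldOf_const rho psi0 c sQ).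
    by rewrite -dE; apply: (uc); rewrite -(fmorph_eq0 eps) dE fmorph_eq0.
  apply/orP; right; apply/asboolP; rewrite -(subrK (u *~ z) h) psiD.
  apply: frac_unitM => //; last first.
    by rewrite (charMz psi0 psiD); exact: frac_unit_expz.
  have [d dE] := (subfieldP rho psi0 psiD _ sQ).1 (fieldOf_psi rho psi0 sQ Qz).
  by rewrite -dE; apply: (uc); rewrite -(fmorph_eq0 eps) dE (char_neq0 psi0 psiD).
by case/orP => [|/asboolP //]; rewrite (negbTE x0).
Qed.

End SimpleExtension.
End Presented.

(** * A group of units is free modulo another presentation *)

Lemma fact_dvdn i j : (i <= j)%N -> (i`! %| j`!)%N.
Proof.
elim: j => [|j IH]; first by rewrite leqn0 => /eqP ->.
rewrite leq_eqVlt => /orP[/eqP -> //|]; rewrite ltnS => /IH h.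
by rewrite factS dvdn_mull.
Qed.

Section Freeness.
Variables (G H : zmodType) (K : fieldType) (rho : {rmorphism rat -> K}).
Variables (psi : H -> K) (chi : G -> K).
Hypothesis pres : presentation rho psi.
Hypothesis chi0 : chi 0 = 1.
Hypothesis chiD : forall g h, chi (g + h) = chi g * chi h.
Hypothesis tfH : forall (h : H) n, (0 < n)%N -> h *+ n = 0 -> h = 0.
Implicit Types (P Q : set H) (h t u : H).

Local Notation fieldOf := (fieldOf rho psi).
Let psi0 := pres0 pres.
Let psiD := presD pres.

(** The preimage in [G] of [Q(psi Q)^* psi H]: these subgroups filter [G] from the
    constants ([Q = 0]) up to [G] itself ([Q = H]). *)
Definition over Q : set G := [set g | exists x h, fieldOf Q x /\ chi g = x * psi h].

Lemma over_subgroup Q : is_subgroup Q -> is_subgroup (over Q).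
Proof.
move=> sQ; split.
  by exists 1, 0; rewrite chi0 psi0 mulr1; split=> //; exact: (fieldOf1 rho psi0).
move=> g g' [x [h [Fx E]]] [x' [h' [Fx' E']]]; exists (x / x'), (h - h').
split; first exact: (fieldOf_div psi0 psiD).
by rewrite (charB chi0 chiD) E E' (charB psi0 psiD) mulf_div.
Qed.

Lemma over_mono Q Q' : Q `<=` Q' -> over Q `<=` over Q'.
Proof.
by move=> QQ' g [x [h [Fx E]]]; exists x, h; split=> //; apply: fieldOf_mono Fx.
Qed.

Lemma over_bigcup (F : set (set H)) : F !=set0 -> total_on F subset ->
  over (\bigcup_(Q in F) Q) `<=` \bigcup_(Q in F) over Q.
Proof.
move=> F0 Ftot g [x [h [/(fieldOf_bigcup F0 Ftot)[Q FQ Fx] E]]].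
by exists Q => //; exists x, h.
Qed.

(** Valuations of [fieldOf Q'] that detect [fieldOf Q] up to [psi Q'] transfer
    to coordinates on [G]. *)
Lemma basis_mod_valuations Q Q' (Sigma : eqType) (c : Sigma -> K -> int) :
  is_subgroup Q -> is_subgroup Q' -> Q `<=` Q' ->
  (forall s x y, x != 0 -> y != 0 -> fieldOf Q' x -> fieldOf Q' y ->
     c s (x * y) = c s x + c s y) ->
  (forall x, x != 0 -> fieldOf Q' x ->
     exists F : seq Sigma, forall s, c s x <> 0 -> s \in F) ->
  (forall x, x != 0 -> fieldOf Q' x -> (forall s, c s x = 0) ->
     exists y h, [/\ fieldOf Q y, Q' h & x = y * psi h]) ->
  (forall y h s, y != 0 -> fieldOf Q y -> Q' h -> c s (y * psi h) = 0) ->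
  exists X, basis_mod (over Q) (over Q') X.
Proof.
move=> sQ sQ' QQ' cM cfin cker1 cker2.
have psin0 h : psi h != 0 := char_neq0 psi0 psiD h.
have chin0 g : chi g != 0 := char_neq0 chi0 chiD g.
have sO' := over_subgroup sQ'.
have cpsi s h : Q' h -> c s (psi h) = 0.
  by move=> Qh; rewrite -[psi h]mul1r cker2 ?oner_neq0 //; exact: (fieldOf1 rho psi0).
have ex g : exists x, over Q' g -> fieldOf Q' x /\ exists h, chi g = x * psi h.
  have [[x [h [Fx E]]]|nO] := pselect (over Q' g); last by exists 0.
  by exists x => _; split=> //; exists h.
have [f hf] := choice ex.
have fn0 g : over Q' g -> f g != 0.
  move=> /hf[_ [h E]]; apply: contraNneq (chin0 g) => f0; by rewrite E f0 mul0r.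
have cV s x : x != 0 -> fieldOf Q' x -> c s x^-1 = - c s x.
  move=> x0 Fx; apply/eqP; rewrite -addr_eq0 -cM ?invr_eq0 //;
    last exact: (fieldOfV psi0 psiD).
  by rewrite mulVf // -psi0 cpsi //; case: sQ'.
have key s g x h : over Q' g -> x != 0 -> fieldOf Q' x -> chi g = x * psi h ->
  c s (f g) = c s x.
  move=> Og x0 Fx E; have [Ff [h' E']] := hf g Og.
  have Efx : f g = x * psi (h - h').
    by rewrite (charB psi0 psiD) mulrA -E E' mulfK.
  have Qh : Q' (h - h').
    apply: (fieldOf_psiP pres) => //.
    have -> : psi (h - h') = f g / x by rewrite Efx mulrC mulKf.
    exact: (fieldOf_div psi0 psiD).
  rewrite Efx cM // ?cpsi ?addr0 //; exact: (fieldOf_psi rho psi0).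
have [|| X hX] := @basis_mod_coords G Sigma (over Q') (fun s g => c s (f g)) sO'.
- move=> s g g' Og Og'; have [Ff [h E]] := hf g Og; have [Ff' [h' E']] := hf g' Og'.
  rewrite (@key s (g - g') (f g / f g') (h - h')); first last.
  + by rewrite (charB chi0 chiD) E E' (charB psi0 psiD) mulf_div.
  + exact: (fieldOf_div psi0 psiD).
  + by rewrite mulf_neq0 ?invr_eq0 ?fn0.
  + exact: sO'.2.
  rewrite cM ?invr_eq0 ?fn0 //; last exact: (fieldOfV psi0 psiD).
  by rewrite cV ?fn0.
- by move=> g Og; apply: cfin; [exact: fn0 | case: (hf g Og)].
exists X; congr (basis_mod _ _ _): hX; apply/seteqP; split=> g.
  case=> Og cg; have [Ff [h E]] := hf g Og.
  have [y [h' [Fy Qh' Ey]]] := cker1 _ (fn0 g Og) Ff cg.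
  by exists y, (h' + h); split=> //; rewrite E Ey psiD mulrA.
move=> Og; have Og' := over_mono QQ' Og; split=> // s.
case: Og => y [h [Fy E]].
have y0 : y != 0 by apply: contraNneq (chin0 g) => y0; rewrite E y0 mul0r.
rewrite (key s g y h) //; last exact: fieldOf_mono Fy.
by rewrite -[y]mulr1 -psi0 cker2 //; case: sQ'.
Qed.

Local Notation eps Q := (incl rho psi Q).

Section Steps.
Variables (Q : set H) (u : H).
Hypotheses (sQ : is_subgroup Q) (uQ : forall z : int, Q (u *~ z) -> z = 0).
Let transc := psi_transcendental pres sQ uQ.
Let sQ' := addZ_subgroup u sQ.

Lemma psi_addZ h : addZ Q u h ->
  exists c (z : int), c != 0 /\ psi h = eps Q c * psi u ^ z.
Proof.
move=> [z Qz]; have [c cE] := (subfieldP rho psi0 psiD _ sQ).1 (fieldOf_psi rho psi0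
  sQ Qz).
exists c, z; rewrite -(fmorph_eq0 (eps Q)) cE (char_neq0 psi0 psiD); split=> //.
by rewrite -(charMz psi0 psiD) -psiD subrK.
Qed.

Lemma eps_frac_unit c : c != 0 -> frac_unit (eps Q) (psi u) (eps Q c).
Proof.
by move=> c0; rewrite -(evC (eps Q) (psi u)); apply: frac_unit_ev => //;
  rewrite polyC_eq0.
Qed.

Lemma psiu_frac_unit : frac_unit (eps Q) (psi u) (psi u).
Proof.
by rewrite -{2}(evX (eps Q) (psi u)); apply: frac_unit_ev => //; rewrite polyX_eq0.
Qed.

(** [fieldOf (Q + Z u)] is purely transcendental over [fieldOf Q], and the group
    [k(u)^* / k^* u^Z] is free on the irreducible polynomials other than [u]. *)
Lemma basis_mod_free_step : exists X, basis_mod (over Q) (over (addZ Q u)) X.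
Proof.
pose good (pi : {poly subfield rho psi Q}) := monic_irred pi /\ pi <> 'X.
pose c pi x := if pselect (good pi) is left _ then ord (eps Q) (psi u) pi x else 0.
have cE pi x : good pi -> c pi x = ord (eps Q) (psi u) pi x.
  by rewrite /c; case: pselect.
have cN pi x : ~ good pi -> c pi x = 0 by rewrite /c; case: pselect.
have Fu x : x != 0 -> fieldOf (addZ Q u) x -> frac_unit (eps Q) (psi u) x.
  exact: (fieldOf_frac_unit pres).
apply: (basis_mod_valuations (c := c)) => //.
- exact: addZ_sub.
- move=> pi x y x0 y0 Fx Fy; have [g|ng] := pselect (good pi); last by rewrite !cN.
  rewrite !cE // ordM //; [exact: g.1.1 | exact: Fu | exact: Fu].
- move=> x x0 Fx; have [F hF] := ord_finite transc (Fu x x0 Fx).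
  exists F => pi; have [g|ng] := pselect (good pi); last by rewrite cN.
  by rewrite cE //; apply: hF; exact: g.1.
- move=> x x0 Fx cx; have [|d [j [d0 E]]] := frac_ord0 transc (Fu x x0 Fx).
    by move=> pi mi piX; rewrite -cE.
  exists (eps Q d), (u *~ j); split.
  + by apply/(subfieldP rho psi0 psiD) => //; exists d.
  + by exists j; rewrite subrr; case: sQ.
  + by rewrite E (charMz psi0 psiD).
move=> y h pi y0 Fy Qh; have [g|ng] := pselect (good pi); last by rewrite cN.
have [d dE] := (subfieldP rho psi0 psiD _ sQ).1 Fy.
have d0 : d != 0 by rewrite -(fmorph_eq0 (eps Q)) dE.
have [e [z [e0 E]]] := psi_addZ Qh.
have irr := g.1.1; have uu := psiu_frac_unit.
rewrite cE // -dE E mulrA -rmorphM ordM //; last 2 first.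
- by apply: eps_frac_unit; rewrite mulf_neq0.
- exact: frac_unit_expz.
rewrite ord_const ?mulf_neq0 // ord_expz ?addr0 //.
by apply: ord_u => //; [exact: g.1 | exact: g.2].
Qed.

(** [fieldOf (Q + Z u)] is a Kummer extension of [fieldOf (Q + Z t)]; the
    differences of valuations at linked primes are the coordinates. *)
Lemma basis_mod_kummer_step t q m : Q q -> (0 < m)%N -> t = q + u *+ m ->
  exists X, basis_mod (over (addZ Q t)) (over (addZ Q u)) X.
Proof.
move=> Qq m0 tE.
have tQ (z : int) : Q (t *~ z) -> z = 0.
  rewrite tE mulrzDl => Qt; have : Q (u *~ (m%:Z * z)).
    rewrite mulrzA -[_ *~ z](addKr (q *~ z)) addrC; apply: sQ.2 => //.
    exact: subgroupMz.
  by move/uQ/eqP; rewrite mulf_eq0 eqz_nat; case: (m) m0 => //= j _ /eqP.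
have [a aE] := (subfieldP rho psi0 psiD _ sQ).1 (fieldOf_psi rho psi0 sQ Qq).
have a0 : a != 0 by rewrite -(fmorph_eq0 (eps Q)) aE (char_neq0 psi0 psiD).
have char0 n := @subfield_char0 _ _ rho psi Q n.
have evt (p : {poly subfield rho psi Q}) :
    ev (eps Q) (psi u) (p \Po kummer a m) = ev (eps Q) (psi t) p.
  rewrite /ev map_comp_poly horner_comp; congr (_.[_]).
  by rewrite /kummer map_polyZ map_polyXn hornerZ hornerXn tE psiD aE pmulrn (charMz
    psi0 psiD).
have st := addZ_subgroup t sQ.
have tu : addZ Q t `<=` addZ Q u.
  move=> h [z Qz]; exists (m%:Z * z).
  have -> : h - u *~ (m%:Z * z) = h - t *~ z + q *~ z.
    by rewrite mulrzA tE mulrzDl opprD [- _ + - _]addrC addrA subrK.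
  by apply: subgroupD => //; exact: subgroupMz.
pose good (s : {poly subfield rho psi Q} * {poly subfield rho psi Q}) :=
  [/\ monic_irred s.1, s.1 <> 'X, monic_irred s.2, s.2 <> 'X & linked a m s.1 s.2].
pose c s x := if pselect (good s) is left _
  then ord (eps Q) (psi u) s.1 x - ord (eps Q) (psi u) s.2 x else 0.
have cE s x : good s -> c s x = ord (eps Q) (psi u) s.1 x - ord (eps Q) (psi u) s.2 x.
  by rewrite /c; case: pselect.
have cN s x : ~ good s -> c s x = 0 by rewrite /c; case: pselect.
have Fu x : x != 0 -> fieldOf (addZ Q u) x -> frac_unit (eps Q) (psi u) x.
  exact: (fieldOf_frac_unit pres).
apply: (basis_mod_valuations (c := c)) => //.
- move=> s x y x0 y0 Fx Fy; have [g|ng] := pselect (good s);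
  last by rewrite !cN // addr0.
  have [[irr _] _ [irr' _] _ _] := g.
  rewrite !cE // !ordM //; try exact: Fu.
  by rewrite opprD addrACA.
- move=> x x0 Fx; have [F hF] := ord_finite transc (Fu x x0 Fx).
  have [L hL] : exists L : {poly subfield rho psi Q} -> seq {poly subfield rho psi Q},
      forall pi, monic_irred pi -> pi <> 'X -> forall pi', monic_irred pi' ->
      linked a m pi pi' -> pi' \in L pi.
    suff h (pi : {poly subfield rho psi Q}) : exists L : seq {poly subfield rho psi Q},
        monic_irred pi -> pi <> 'X -> forall pi', monic_irred pi' ->
        linked a m pi pi' -> pi' \in L.
      by have [L hL] := choice h; exists L.
    have [mi|nmi] := pselect (monic_irred pi); last by exists [::].
    have [piX|piX] := pselect (pi = 'X); first by exists [::].
    have [L hL] := linked_finite char0 a0 m0 mi piX.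
    by exists L => _ _; exact: hL.
  (* One member of a pair with a nonzero coordinate is in the divisor of [x],
     and a prime is linked to finitely many others. *)
  exists ([seq (pi, pi') | pi <- F, pi' <- L pi] ++ [seq (pi', pi) | pi <- F,
    pi' <- L pi]).
  move=> s; have [g|ng] := pselect (good s); last by rewrite cN.
  rewrite cE // mem_cat; case: s g => pi pi' [/= mi piX mi' pi'X lk] ne.
  have [o1|o1] := eqVneq (ord (eps Q) (psi u) pi x) 0; last first.
    apply/orP; left; apply/allpairsPdep; exists pi, pi'; split=> //.
      by apply: hF => //; exact/eqP.
    exact: hL.
  have [o2|o2] := eqVneq (ord (eps Q) (psi u) pi' x) 0.
    by case: ne; rewrite o1 o2 subrr.
  apply/orP; right; apply/allpairsPdep; exists pi', pi; split=> //.
    by apply: hF => //; exact/eqP.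
  by apply: hL => //; exact: linked_sym.
- move=> x x0 Fx cx; have [|p [q' [j [p0 q0 E]]]] := frac_linked transc char0 a0 m0
  (Fu x x0 Fx).
    move=> pi pi' mi piX mi' pi'X lk; apply/eqP;
      rewrite -subr_eq0 -[_ - _](@cE (pi, pi')) //.
    by rewrite cx.
  exists (ev (eps Q) (psi t) p / ev (eps Q) (psi t) q'), (u *~ j); split.
  + by apply: (fieldOf_div psi0 psiD) => //; exact: (fieldOf_addZ_ev pres).
  + by exists j; rewrite subrr; case: sQ.
  + by rewrite E !evt (charMz psi0 psiD).
move=> y h s y0 Fy Qh; have [g|ng] := pselect (good s); last by rewrite cN.
have [p [q' [p0 q0 yE]]] := fieldOf_frac_unit pres sQ tQ y0 Fy.
have [e [z [e0 E]]] := psi_addZ Qh.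
have [mi piX mi' pi'X lk] := g.
rewrite cE // (@sub_frac_ord _ _ _ _ transc a m char0 a0 m0 _ s.1 s.2) ?subrr //.
exists (e *: p), q', z; rewrite scaler_eq0 negb_or e0; split=> //.
rewrite yE E !evt -mul_polyC evM evC mulrA; congr (_ * _).
by rewrite mulrAC [ev _ _ p * _]mulrC.
Qed.

End Steps.

(** Purity of the base of a step makes the new units transcendental. *)
Definition pure P := forall h n, (0 < n)%N -> P (h *+ n) -> P h.

Section PureStep.
Variables (P : set H) (h0 : H).
Hypotheses (sP : is_subgroup P) (pP : pure P) (h0P : ~ P h0).

(** [level N] consists of the [h] with [N h] in [P + Z h0]; along the factorials
    it exhausts the pure closure of [P + Z h0]. *)
Definition level (N : nat) : set H := [set h | exists z : int, P (h *+ N - h0 *~ z)].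

Lemma pure_mulrz z : P (h0 *~ z) -> z = 0.
Proof.
move=> Pz; apply: contrapT => /eqP z0; apply: h0P.
apply: (pP (n := `|z|%N)); first by rewrite absz_gt0.
rewrite pmulrn; have [zp|zn] := lerP 0 z; first by rewrite gez0_abs.
by rewrite ltz0_abs // mulrNz; exact: subgroupN.
Qed.

Lemma level_subgroup N : is_subgroup (level N).
Proof.
split; first by exists 0; rewrite mul0rn mulr0z subrr; case: sP.
move=> h h' [z Pz] [z' Pz']; exists (z - z').
by rewrite mulrzBr mulrnBl opprD opprK addrACA -[- (h' *+ N) + _]opprK opprD opprK;
  apply: sP.2.
Qed.

Lemma level_dvd N N' : (N %| N')%N -> level N `<=` level N'.
Proof.
case/dvdnP => k -> h [z Pz]; exists (z * k%:Z).
rewrite mulnC mulrnA mulrzA -pmulrn -mulrnBl pmulrn; exact: subgroupMz.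
Qed.

(** As [P] is pure and does not contain [h0], the quotient of [level N] by [P]
    embeds in Z by [h |-> z], hence is cyclic. *)
Lemma level_generator N : (0 < N)%N ->
  exists t d, [/\ (0 < d)%N, P (t *+ N - h0 *~ d%:Z) & level N = addZ P t].
Proof.
move=> N0.
have ex : exists d, `[< (0 < d)%N /\ exists t, P (t *+ N - h0 *~ d%:Z) >].
  by exists N; apply/asboolP; split=> //; exists h0; rewrite subrr; case: sP.
case: (ex_minnP ex) => d /asboolP[d0 [t Pt]] dmin; exists t, d; split=> //.
apply/seteqP; split=> h [z Pz].
  pose w := (z %/ d%:Z)%Z; exists w; apply: (pP N0).
  have Pr : P ((h - t *~ w) *+ N - h0 *~ (z %% d%:Z)%Z).
    have -> : (h - t *~ w) *+ N - h0 *~ (z %% d%:Z)%Z =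
        (h *+ N - h0 *~ z) - (t *+ N - h0 *~ d%:Z) *~ w.
      have E (A B C D : H) : A - B - D = A - (C + D) - (B - C).
        by rewrite opprB opprD !addrA [A - C - D + C]addrAC subrK addrAC.
      rewrite mulrnBl mulrzBl [t *~ w *+ N]pmulrn mulrzAC -pmulrn -mulrzA.
      have zE : h0 *~ z = h0 *~ (d%:Z * w) + h0 *~ (z %% d%:Z)%Z.
        by rewrite -mulrzDr [d%:Z * w]mulrC -divz_eq.
      by rewrite zE; exact: E.
    by apply: sP.2 => //; exact: subgroupMz.
  have r0 : (z %% d%:Z)%Z = 0.
    apply: contrapT => /eqP r0.
    have rp : 0 <= (z %% d%:Z)%Z by rewrite modz_ge0 // eqz_nat -lt0n.
    have : (d <= `|(z %% d%:Z)%Z|)%N.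
      apply: dmin; apply/asboolP; rewrite absz_gt0; split=> //.
      by exists (h - t *~ w); rewrite gez0_abs.
    by rewrite leqNgt -ltz_nat gez0_abs // ltz_pmod.
  by rewrite r0 mulr0z subr0 in Pr.
exists (d%:Z * z).
have -> : h *+ N - h0 *~ (d%:Z * z) = (h - t *~ z) *+ N + (t *+ N - h0 *~ d%:Z) *~ z.
  by rewrite mulrnBl mulrzBl [t *~ z *+ N]pmulrn mulrzAC -pmulrn -mulrzA addrA subrK.
by apply: subgroupD => //; [apply: (subgroupMz (Posz N)) | exact: subgroupMz].
Qed.

(** The rank one extension from [P] to the pure closure of [P + Z h0] is a
    transcendental step followed by countably many Kummer steps. *)
Lemma basis_mod_pure_step :
  exists X, basis_mod (over P) (over (\bigcup_n level n`!)) X.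
Proof.
pose R n := if n is n'.+1 then level n'`! else P.
have sR n : is_subgroup (R n) by case: n => // n; exact: level_subgroup.
have levelP N : P `<=` level N.
  move=> h Ph; exists 0; rewrite mulr0z subr0; exact: (subgroupMz (Posz N)).
have Rle n : R n `<=` R n.+1.
  case: n => [|n]; first exact: levelP.
  by apply: level_dvd; rewrite factS dvdn_mull.
have gen n := level_generator (fact_gt0 n).
have uP N d t : (0 < d)%N -> P (t *+ N - h0 *~ d%:Z) -> forall z : int, P (t *~ z) ->
  z = 0.
  move=> d0 Pt z Pz; have : P (h0 *~ (d%:Z * z)).
    have -> : h0 *~ (d%:Z * z) = (t *~ z) *~ N%:Z - (t *+ N - h0 *~ d%:Z) *~ z.
      by rewrite mulrzBl pmulrn -!mulrzA [z * _]mulrC opprB addrC subrK.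
    by apply: sP.2; exact: subgroupMz.
  by move/pure_mulrz/eqP; rewrite mulf_eq0 eqz_nat; case: (d) d0 => //= j _ /eqP.
have [X hX] : exists X, basis_mod (over (R 0%N)) (\bigcup_n over (R n)) X.
  apply: basis_mod_omega.
  - by move=> n; exact: over_subgroup.
  - by move=> n; exact: over_mono.
  case=> [|n] /=.
    have [t [d [d0 Pt ->]]] := gen 0%N; apply: basis_mod_free_step => //.
    exact: uP d0 Pt.
  have [t [d [d0 Pt Et]]] := gen n; have [u [e [e0 Pu Eu]]] := gen n.+1.
  rewrite Et Eu.
  have [m Pm] : addZ P u t.
    rewrite -Eu; apply: (Rle n.+1); rewrite /= Et; exists 1.
    by rewrite mulr1z subrr; case: sP.
  (* Both sides are the coefficient of [h0] in [(n+1)! t] modulo [P]; this makes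
     [m] positive. *)
  have mE : m * e%:Z = d%:Z * n.+1%:Z.
    apply/eqP; rewrite -subr_eq0; apply/eqP/pure_mulrz.
    have -> : h0 *~ (m * e%:Z - d%:Z * n.+1%:Z) =
       (t *+ n`! - h0 *~ d%:Z) *~ n.+1%:Z - (u *+ (n.+1)`! - h0 *~ e%:Z) *~ m - (t -
         u *~ m) *~ (n.+1)`!%:Z.
      have E (A B C D : H) : D - C = A - C - (B - D) - (A - B).
        by rewrite !opprB !addrA subrK addrAC [A - C]addrC addrK addrC.
      rewrite !mulrzBl (_ : t *+ n`! *~ n.+1%:Z = t *~ (n.+1)`!%:Z); last first.
        by rewrite pmulrn -mulrzA factS PoszM mulrC.
      rewrite [u *+ _]pmulrn [u *~ m *~ _]mulrzAC mulrzBr [m * e%:Z]mulrC !mulrzA.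
      exact: E.
    by apply: sP.2; [apply: sP.2|]; exact: subgroupMz.
  have m0 : 0 < m.
    have : 0 < m * e%:Z by rewrite mE mulr_gt0 // ltz_nat.
    by rewrite pmulr_lgt0 // ltz_nat.
  apply: (@basis_mod_kummer_step P u sP (uP _ _ _ e0 Pu) t (t - u *~ m) `|m|%N) => //.
    by rewrite absz_gt0 gt_eqF.
  by rewrite pmulrn gtz0_abs // subrK.
exists X; congr (basis_mod _ _ _): hX; apply/seteqP; split=> g.
  case=> -[|n] _ Og; last by apply: over_mono Og => h lh; exists n.
  by apply: over_mono Og => h Ph; exists 0%N => //; exact: levelP.
have -> : \bigcup_n level n`! = \bigcup_(Q in range (fun n => level n`!)) Q.
  by rewrite bigcup_image.
move/over_bigcup => [||_ [n _ <-] Og].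
- by exists (level 0`!), 0%N.
- have mono i j : (i <= j)%N -> level i`! `<=` level j`! by move=> ij;
  apply: level_dvd; exact: fact_dvdn.
  move=> _ _ [i _ <-] [j _ <-].
  by case/orP: (leq_total i j) => ij; [left | right]; exact: mono.
- by exists n.+1.
Qed.

Lemma level_union_pure : is_subgroup (\bigcup_n level n`!) /\ pure (\bigcup_n level
  n`!).
Proof.
have mono i j : (i <= j)%N -> level i`! `<=` level j`!.
  by move=> ij; apply: level_dvd; exact: fact_dvdn.
split.
  split; first by exists 0%N => //; case: (level_subgroup 0`!).
  move=> h h' [i _ li] [j _ lj]; exists (maxn i j) => //.
  by apply: (level_subgroup _).2; [apply: mono li; exact: leq_maxl | apply: mono lj;
    exact: leq_maxr].
move=> h n n0 [i _ [z Pz]]; exists (n * i`!)%N => //.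
have : level (n * i`!) h by exists z; rewrite mulrnA.
apply: level_dvd; apply: dvdn_fact.
by rewrite muln_gt0 n0 fact_gt0 leqnn.
Qed.

Lemma level_union_sub : P `<=` \bigcup_n level n`!.
Proof. by move=> h Ph; exists 0%N => //; exists 0; rewrite mulr1n mulr0z subr0. Qed.

Lemma level_union_h0 : (\bigcup_n level n`!) h0.
Proof. by exists 0%N => //; exists 1; rewrite mulr1n mulr1z subrr; case: sP. Qed.

End PureStep.

(** Pure subgroups of [H] are closed under unions of chains, and each proper one
    has a rank one extension, so the steps compose from 0 to [H]. *)
Theorem basis_mod_constants : exists X,
  basis_mod [set g | exists c h, chi g = rho c * psi h] setT X.
Proof.
have -> : [set g | exists c h, chi g = rho c * psi h] = over [set 0].
  have s0 : is_subgroup [set 0 : H] by split=> // x y -> ->; rewrite subr0.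
  apply/seteqP; split=> g.
    by case=> c [h E]; exists (rho c), h; split=> //; exact: (fieldOf_const rho psi0).
  by case=> x [h [/(fieldOf0 psi0)[c ->] E]]; exists c, h.
have -> : [set: G] = over setT.
  by apply/seteqP; split=> // g _; exists (chi g), 0; rewrite psi0 mulr1; split=> //;
    exact: fieldOfT.
apply: (@basis_mod_chain G H (fun Q => is_subgroup Q /\ pure Q) over [set 0] setT).
- by move=> Q [sQ _]; exact: over_subgroup.
- by move=> Q Q' _ _; exact: over_mono.
- split; first by split=> // x y -> ->; rewrite subr0.
  by move=> h n n0; exact: tfH.
- move=> F [Q0 FQ0] Fok Ftot; split; last by apply: over_bigcup => //; exists Q0.
  split.
    split; first by exists Q0 => //; case: (Fok Q0 FQ0) => -[].
    move=> x y [Q FQ Qx] [Q' FQ' Q'y]; case: (Ftot Q Q' FQ FQ') => QQ'.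
      by exists Q' => //; apply: (Fok Q' FQ').1.2 => //; exact: QQ'.
    by exists Q => //; apply: (Fok Q FQ).1.2 => //; exact: QQ'.
  by move=> h n n0 [Q FQ Qh]; exists Q => //; apply: (Fok Q FQ).2 Qh.
move=> Q [sQ pQ] _ QT.
have [h0 h0Q] : exists h0, ~ Q h0.
  apply: contrapT => nQ; apply: QT; apply/seteqP; split=> // h _.
  by apply: contrapT => Qh; apply: nQ; exists h.
exists (\bigcup_n level Q h0 n`!); split.
- exact: level_union_pure.
- split; first exact: level_union_sub.
  by move/(_ h0 (level_union_h0 h0 sQ)).
- exact: basis_mod_pure_step.
Qed.

End Freeness.

(** * Logarithmic derivations and the rank *)

Section Derivations.
Variables (K : fieldType) (rho : {rmorphism rat -> K}).

Definition derivation (D : K -> K) : Prop :=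
  [/\ forall x y, D (x + y) = D x + D y,
      forall x y, D (x * y) = D x * y + x * D y
    & forall c, D (rho c) = 0].

Section DerivationTheory.
Variable D : K -> K.
Hypothesis derD : derivation D.

Lemma derivation0 : D 0 = 0.
Proof. by case: derD => _ _ Dc; rewrite -{1}(rmorph0 rho) Dc. Qed.

Lemma derivation_const c x : D (rho c * x) = rho c * D x.
Proof. by case: derD => _ DM Dc; rewrite DM Dc mul0r add0r. Qed.

Lemma derivation_div0 x y : D x = 0 -> D y = 0 -> D (x / y) = 0.
Proof.
case: derD => _ DM Dc Dx Dy; have [->|y0] := eqVneq y 0;
  first by rewrite invr0 mulr0 derivation0.
have : D (x / y * y) = D x by rewrite divfK.
by rewrite DM Dx Dy mulr0 addr0 => /eqP; rewrite mulf_eq0 (negbTE y0) orbF => /eqP.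
Qed.

Lemma derivation_char0 (G : zmodType) (chi : G -> K) : chi 0 = 1 ->
  (forall g h, chi (g + h) = chi g * chi h) -> is_subgroup [set g | D (chi g) = 0].
Proof.
move=> chi0 chiD; case: (derD) => _ DM Dc; split.
  by rewrite /= chi0 -(rmorph1 rho) Dc.
by move=> g h /= Dg Dh; rewrite (charB chi0 chiD); exact: derivation_div0.
Qed.

End DerivationTheory.

(** On the group algebra, multiplying the monomial of exponent [g] by [e g]
    satisfies the Leibniz rule because [e] is additive; the quotient rule
    extends it to the field. *)
Lemma log_derivation (G : zmodType) (chi : G -> K) (e : G -> int) :
  presentation rho chi -> (forall g h, e (g - h) = e g - e h) ->
  exists2 D, derivation D & forall g, D (chi g) = chi g *~ e g.
Proof.
move=> pres eB; have [chi0 chiD] := (pres0 pres, presD pres).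
have e0 : e 0 = 0 by rewrite -(subrr (0 : G)) eB subrr.
have eD g h : e (g + h) = e g + e h.
  by rewrite -{1}[h]opprK eB -[- h]sub0r eB e0 sub0r opprK.
pose phi g := chi g *~ e g.
pose ev := mmap rho chi; pose dev := mmap rho phi.
have dev_shift q u : dev (shift q u) = dev q * chi u + ev q * phi u.
  rewrite /dev /ev raddf_sum !mmapE !mulr_suml -big_split /=; apply: eq_bigr => g _.
  rewrite mmapU /phi eD chiD mulrzDr -[_ *~ e g]mulrzr -[_ *~ e u]mulrzr -[chi g *~ e
    g]mulrzr -[chi u *~ e u]mulrzr.
  by ring.
have evM p q : ev (gmul p q) = ev p * ev q by exact: (gev_gmul rho chiD).
have devM p q : dev (gmul p q) = dev p * ev q + ev p * dev q.
  have -> : dev (gmul p q) = \sum_(g <- msupp p) rho p@_g * dev (shift q g).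
    by rewrite /dev raddf_sum; apply: eq_bigr => g _; rewrite /= mmap_scale.
  rewrite [dev p]mmapE [ev p]mmapE !mulr_suml -big_split /=.
  by apply: eq_bigr => g _; rewrite dev_shift; ring.
have ev_inj p q : ev p = ev q -> p = q.
  move=> E; apply/eqP; rewrite -subr_eq0; apply/eqP/(pres_inj pres).
  by rewrite raddfB /= -/ev E subrr.
have ex x : exists y, forall p q, ev q != 0 -> x = ev p / ev q ->
    y = (dev p - x * dev q) / ev q.
  have [p [q [q0 E]]] := pres_frac pres x; exists ((dev p - x * dev q) / ev q).
  move=> p' q' q'0 E'; have/ev_inj/(congr1 dev) : ev (gmul p q') = ev (gmul p' q).
    by apply/eqP; rewrite !evM -eqr_div // -E -E'.
  have pE : ev p = x * ev q by rewrite E divfK.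
  have p'E : ev p' = x * ev q' by rewrite E' divfK.
  rewrite !devM pE p'E => EE; apply/eqP; rewrite eqr_div // -subr_eq0.
  have -> : (dev p - x * dev q) * ev q' - (dev p' - x * dev q') * ev q =
    (dev p * ev q' + x * ev q * dev q') - (dev p' * ev q + x * ev q' * dev q) by ring.
  by rewrite EE subrr.
have [D hD] := choice ex.
have DevE p : D (ev p) = dev p.
  have ev1 : ev << 1 *g 0 >> = 1 by rewrite /ev gevU rmorph1 chi0 mulr1.
  have dev1 : dev << 1 *g 0 >> = 0 by rewrite /dev gevU /phi e0 mulr0z mulr0.
  by rewrite (hD _ p << 1 *g 0 >>) ev1 ?oner_neq0 ?divr1 // dev1 mulr0 subr0.
exists D; last first.
  move=> g; have E : chi g = ev << 1 *g g >> by rewrite /ev gevU rmorph1 mul1r.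
  by rewrite {1}E DevE /dev gevU rmorph1 mul1r.
split=> [x y|x y|c].
- have [p [q [q0 E]]] := pres_frac pres x; have [p' [q' [q'0 E']]] := pres_frac pres y.
  rewrite -/(ev _) in q0 q'0 E E'; rewrite -/(ev _) in E; rewrite -/(ev _) in E'.
  have evA r s : ev (r + s) = ev r + ev s by rewrite /ev raddfD.
  have devA r s : dev (r + s) = dev r + dev s by rewrite /dev raddfD.
  rewrite (hD x p q) // (hD y p' q') // (hD _ (gmul p q' + gmul p' q) (gmul q q')).
  + rewrite devA !evM !devM E E'; field; by rewrite q0 q'0.
  + by rewrite evM mulf_neq0.
  + by rewrite evA !evM E E' addf_div.
- have [p [q [q0 E]]] := pres_frac pres x; have [p' [q' [q'0 E']]] := pres_frac pres y.
  rewrite -/(ev _) in q0 q'0 E E'; rewrite -/(ev _) in E; rewrite -/(ev _) in E'.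
  rewrite (hD x p q) // (hD y p' q') // (hD _ (gmul p p') (gmul q q')).
  + rewrite !evM !devM E E'; field; by rewrite q0 q'0.
  + by rewrite evM mulf_neq0.
  + by rewrite !evM E E' mulf_div.
- have -> : rho c = ev << c *g 0 >> by rewrite /ev gevU chi0 mulr1.
  by rewrite DevE /dev gevU /phi e0 mulr0z mulr0.
Qed.

End Derivations.

Section DifferentialClosure.
Variables (K : fieldType) (rho : {rmorphism rat -> K}) (C : set K).
Implicit Types (X : set K) (D : K -> K).

Definition derivation_over D := derivation rho D /\ forall x, C x -> D x = 0.

(** As [K] has characteristic 0, this is the algebraic closure in [K] of the field
    generated by [C] and [X].  Defined through derivations, it satisfies exchange
    by linear algebra; the finite sequence [s] makes it finitary. *)
Definition dcl X : set K := fun x => exists2 s : seq K, (forall y, y \in s -> X y) &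
  forall D, derivation_over D -> (forall y, y \in s -> D y = 0) -> D x = 0.

Lemma dcl_ext X : X `<=` dcl X.
Proof.
move=> x Xx; exists [:: x] => [y|D _ h]; first by rewrite mem_seq1 => /eqP ->.
by apply: h; rewrite mem_head.
Qed.

Lemma dcl_mono X Y : X `<=` Y -> dcl X `<=` dcl Y.
Proof. by move=> XY x [s sX h]; exists s => // y /sX /XY. Qed.

Lemma dcl_idem X : dcl (dcl X) `<=` dcl X.
Proof.
move=> x [s sX h].
suff [s' s'X hs'] : exists2 s' : seq K, (forall y, y \in s' -> X y) &
    forall D, derivation_over D -> (forall y, y \in s' -> D y = 0) ->
      forall y, y \in s -> D y = 0.
  by exists s' => // D dD Ds'; apply: h => //; exact: (hs' D dD Ds').
elim: s sX {h} => [|y s IH] sX; first by exists [::].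
have [|s1 s1X h1] := IH; first by move=> z zs; apply: sX; rewrite in_cons zs orbT.
have [s2 s2X h2] := sX y (mem_head _ _).
exists (s1 ++ s2) => [z|D dD hD z]; first by rewrite mem_cat => /orP[/s1X|/s2X].
rewrite in_cons => /orP[/eqP ->|].
  by apply: h2 => // w ws; apply: hD; rewrite mem_cat ws orbT.
by apply: h1 => // w ws; apply: hD; rewrite mem_cat ws.
Qed.

Lemma dcl_exchange X a b :
  dcl (X `|` [set a]) b -> ~ dcl X b -> dcl (X `|` [set b]) a.
Proof.
move=> [s sX h] nb; pose s' := [seq y <- s | y != a].
have s'X y : y \in s' -> X y.
  by rewrite mem_filter => /andP[ya /sX[//|/eqP]]; rewrite (negbTE ya).
have [D0 [dD0 D0s D0b]] : exists D, [/\ derivation_over D, forall y, y \in s' ->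
  D y = 0 & D b != 0].
  apply: contrapT => nD; apply: nb; exists s' => // D dD Ds.
  by apply: contrapT => /eqP Db; apply: nD; exists D.
have D0a : D0 a != 0.
  apply: contra D0b => /eqP D0a; apply/eqP; apply: h => // y ys.
  by have [-> //|ya] := eqVneq y a; apply: D0s; rewrite mem_filter ya.
exists (b :: s') => [y|D dD hD].
  by rewrite in_cons => /orP[/eqP ->|/s'X]; [right | left].
have Db : D b = 0 by apply: hD; rewrite mem_head.
(* The combination of [D] and [D0] that kills [a] *)
pose D1 x := D x - D a / D0 a * D0 x.
have dD1 : derivation_over D1.
  case: dD => -[DA DM Dc] DC; case: dD0 => -[D0A D0M D0c] D0C.
  split; last by move=> x Cx; rewrite /D1 (DC x) // (D0C x) // mulr0 subrr.
  split=> [x y|x y|c].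
  - by rewrite /D1 (DA x) (D0A x); ring.
  - by rewrite /D1 (DM x) (D0M x); ring.
  - by rewrite /D1 (Dc c) (D0c c) mulr0 subrr.
have : D1 b = 0.
  apply: h => // y ys; have [->|ya] := eqVneq y a; first by rewrite /D1 divfK // subrr.
  have ys' : y \in s' by rewrite mem_filter ya.
  by rewrite /D1 (D0s y) // (hD y) ?in_cons ?ys' ?orbT // mulr0 subrr.
rewrite /D1 Db sub0r => /eqP; rewrite oppr_eq0 mulf_eq0 (negbTE D0b) orbF mulf_eq0.
by rewrite invr_eq0 (negbTE D0a) orbF => /eqP.
Qed.

Lemma dcl_fin X b : dcl X b ->
  exists2 s : seq K, (forall x, x \in s -> X x) & dcl [set` s] b.
Proof. by move=> [s sX h]; exists s => //; exists s. Qed.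

Definition dcl_card_le :=
  cl_independent_card_le dcl_ext dcl_mono dcl_idem dcl_exchange dcl_fin.

End DifferentialClosure.

Section Rank.
Variables (G H : zmodType) (K : fieldType) (rho : {rmorphism rat -> K}).
Variables (chi : G -> K) (psi : H -> K).
Hypotheses (presG : presentation rho chi) (presH : presentation rho psi).

Lemma pres_char_inj (g h : G) c : chi g = rho c * chi h -> g = h /\ c = 1.
Proof.
move=> E; have p0 : << 1 *g g >> - << c *g h >> = 0 :> {malg rat[G]}.
  by apply: (pres_inj presG); rewrite raddfB /= !gevU rmorph1 mul1r E subrr.
have := congr1 (mcoeff g) p0; rewrite mcoeffB mcoeff0 !mcoeffU eqxx mulr1n.
have [->|_] := eqVneq h g; last by rewrite mulr0n subr0 => /eqP; rewrite oner_eq0.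
by rewrite mulr1n => /eqP; rewrite subr_eq0 => /eqP <-.
Qed.

(** The units that both groups share, up to rational factors. *)
Definition common : set G := [set g | exists c h, chi g = rho c * psi h].

Lemma common_subgroup : is_subgroup common.
Proof.
split; first by exists 1, 0; rewrite (pres0 presG) (pres0 presH) rmorph1 mulr1.
move=> g g' [c [h E]] [c' [h' E']]; exists (c / c'), (h - h').
by rewrite (charB (pres0 presG) (presD presG)) E E' (charB (pres0 presH) (presD presH))
  fmorph_div mulf_div.
Qed.

End Rank.

Lemma common_sym (G H : zmodType) (K : fieldType) (rho : {rmorphism rat -> K})
    (chi : G -> K) (psi : H -> K) (presG : presentation rho chi) g c h : chi g = rho
      c * psi h -> psi h = rho c^-1 * chi g.
Proof.
move=> E; have c0 : c != 0.
  apply: contraNneq (char_neq0 (pres0 presG) (presD presG) g) => c0.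
  by rewrite E c0 rmorph0 mul0r.
by rewrite E mulrA -rmorphM mulVf // rmorph1 mul1r.
Qed.

Section RankLe.
Variables (G H : zmodType) (K : fieldType) (rho : {rmorphism rat -> K}).
Variables (chi : G -> K) (psi : H -> K).
Hypotheses (presG : presentation rho chi) (presH : presentation rho psi).

(** Over the common units, the basis [X] is independent in [K], since the
    derivation dual to [a] in [X] kills the other elements of [X], and the basis
    [Y] spans, since it generates [H] modulo the common units. *)
Lemma basis_card_le (X : set G) (Y : set H) :
  basis_mod (common rho chi psi) setT X -> basis_mod (common rho psi chi) setT Y ->
  X #<= Y.
Proof.
move=> bX bY; have [chi0 chiD] := (pres0 presG, presD presG).
have [psi0 psiD] := (pres0 presH, presD presH).
have sG := common_subgroup presG presH; have sH := common_subgroup presH presG.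
pose C : set K := [set chi g | g in common rho chi psi].
have injchi (g h : G) : chi g = chi h -> g = h.
  by move=> E; have [] := @pres_char_inj _ _ _ _ presG g h 1; rewrite // rmorph1 mul1r.
have injpsi (g h : H) : psi g = psi h -> g = h.
  by move=> E; have [] := @pres_char_inj _ _ _ _ presH g h 1; rewrite // rmorph1 mul1r.
have cX : X #= chi @` X.
  by apply: card_esym; apply: inj_card_eq => g h _ _; exact: injchi.
have cY : psi @` Y #= Y by apply: inj_card_eq => g h _ _; exact: injpsi.
rewrite (card_le_eql cX) -(card_le_eqr cY).
apply: (dcl_card_le (rho := rho) (C := C)).
- move=> _ [a Xa <-] [s sX h].
  have [r [rX rA rB runiq]] := basis_mod_coord sG bX.
  have [|D dD DE] := @log_derivation _ rho _ chi (fun g => (r g)@_a) presG.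
    by move=> g g'; rewrite rB mcoeffB.
  have ra : r a = << 1 *g a >>.
    apply: runiq; first exact: supp_inU.
    by rewrite int_combU mulr1z subrr; case: sG.
  have : D (chi a) = 0.
    apply: h.
      split=> // _ [g Cg <-]; rewrite DE (runiq g 0) ?mcoeff0 ?mulr0z //;
        first exact: supp_in0.
      by rewrite raddf0 subr0.
    move=> y /sX[[b Xb <-] ba]; rewrite DE (runiq b << 1 *g b >>).
    + by rewrite mcoeffU; case: eqP => [e|_]; [case: ba;
      rewrite e | rewrite mulr0n mulr0z].
    + exact: supp_inU.
    + by rewrite int_combU mulr1z subrr; case: sG.
  rewrite DE ra mcoeffUU mulr1z => /eqP; exact/negP/char_neq0.
move=> x; have [p [q [q0 ->]]] := pres_frac presH x.
have [r [rY rA rB runiq]] := basis_mod_coord sH bY.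
exists (flatten [seq [seq psi b | b <- msupp (r h)] | h <- (msupp p : seq H) ++ msupp
  q]).
  move=> y /flattenP[_ /mapP[h _ ->]] /mapP[b br ->]; exists b => //.
  exact: rY br.
move=> D [dD DC] Ds; have [DA DM Dc] := dD.
have sD := derivation_char0 dD psi0 psiD.
have Dpsi h : h \in (msupp p : seq H) ++ msupp q -> D (psi h) = 0.
  move=> hpq; rewrite -(subrK (int_comb (r h)) h).
  apply: (subgroupD sD).
    have [c [g E]] := rA h; rewrite /= E (derivation_const dD) DC ?mulr0 //.
    by exists g => //; exists c^-1, (h - int_comb (r h)); exact: (common_sym presH).
  apply: (subgroup_sum sD) => b br; apply: (subgroupMz _ sD); apply: Ds.
  by apply/flattenP; exists [seq psi b | b <- msupp (r h)];
    [apply: map_f | apply: map_f].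
have D0 (l : {malg rat[H]}) : (forall h, h \in msupp l -> D (psi h) = 0) ->
  D (mmap rho psi l) = 0.
  move=> hl; rewrite mmapE big_seq_cond; apply: (big_ind (fun z => D z = 0)).
  - exact: derivation0 dD.
  - by move=> y z Dy Dz; rewrite DA Dy Dz addr0.
  - by move=> h /andP[/hl Dh _]; rewrite (derivation_const dD) Dh mulr0.
by apply: (derivation_div0 dD); apply: D0 => h hl; apply: Dpsi;
  rewrite mem_cat hl ?orbT.
Qed.

End RankLe.

(** * Two presentations of a field have isomorphic groups *)

Section Pushforward.
Variables (R : zmodType) (G H : choiceType).

Definition push (b : G -> H) (m : {malg R[G]}) : {malg R[H]} :=
  \sum_(g <- msupp m) << m@_g *g b g >>.

Lemma push_is_additive b : zmod_morphism (push b).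
Proof.
have widen (d : {fset G}) m : (msupp m `<=` d)%fset ->
    push b m = \sum_(g <- d) << m@_g *g b g >>.
  move=> le; rewrite /push (big_fset_incl _ le) //= => x _ /mcoeff_outdom ->.
  by rewrite monalgU0.
move=> m1 m2.
rewrite (widen _ _ (msuppB_le m1 m2)).
rewrite (widen _ _ (fsubsetUl (msupp m1) (msupp m2))).
rewrite (widen _ _ (fsubsetUr (msupp m1) (msupp m2))).
by rewrite -sumrB; apply: eq_bigr => g _; rewrite mcoeffB monalgUB.
Qed.

HB.instance Definition _ b := GRing.isZmodMorphism.Build _ _ (push b)
  (push_is_additive b).

Lemma pushU b n g : push b << n *g g >> = << n *g b g >>.
Proof.
have [->|n0] := eqVneq n 0; first by rewrite !monalgU0 raddf0.
by rewrite /push msuppU (negbTE n0) big_seq_fset1 mcoeffUU.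
Qed.

Lemma push_supp b (X : set G) (Y : set H) m :
  (forall g, X g -> Y (b g)) -> supp_in X m -> supp_in Y (push b m).
Proof.
move=> bXY mX; rewrite /push big_seq_cond; apply: (big_ind (@supp_in _ _ Y)).
- exact: supp_in0.
- exact: supp_inD.
- by move=> g /andP[/mX/bXY Yg _]; exact: supp_inU.
Qed.

End Pushforward.

Lemma push_cancel (R : zmodType) (G H : choiceType) (b : G -> H) (b' : H -> G)
    (X : set G) (m : {malg R[G]}) :
  (forall g, X g -> b' (b g) = g) -> supp_in X m -> push b' (push b m) = m.
Proof.
move=> bK mX; rewrite [X in push b' X]/push raddf_sum /= [RHS]monalgE big_seq_cond
  [RHS]big_seq_cond.
by apply: eq_bigr => g /andP[/mX/bK E _]; rewrite pushU E.
Qed.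

Lemma bijective_of_inj_surj (A B : Type) (f : A -> B) :
  injective f -> (forall y, exists x, f x = y) -> bijective f.
Proof.
move=> finj fsurj; have [g hg] := choice fsurj.
by exists g => // x; apply: finj; rewrite hg.
Qed.

(** Both groups are the direct sum of a copy of the group of common units modulo
    rationals and of a free group, and the two free groups have the same rank;
    [q] matches the common units and [b] the bases. *)
Theorem group_isomorphic_of_presentations (G H : zmodType) (K : fieldType)
    (rho : {rmorphism rat -> K}) (chi : G -> K) (psi : H -> K) :
  (forall (g : G) n, (0 < n)%N -> g *+ n = 0 -> g = 0) ->
  (forall (h : H) n, (0 < n)%N -> h *+ n = 0 -> h = 0) ->
  presentation rho chi -> presentation rho psi -> group_isomorphic G H.
Proof.
move=> tfG tfH presG presH.
have [chi0 chiD] := (pres0 presG, presD presG).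
have [psi0 psiD] := (pres0 presH, presD presH).
have [X bX] := basis_mod_constants presH chi0 chiD tfH.
have [Y bY] := basis_mod_constants presG psi0 psiD tfG.
rewrite -/(common rho chi psi) in bX; rewrite -/(common rho psi chi) in bY.
have sG := common_subgroup presG presH; have sH := common_subgroup presH presG.
have [b [bXY binj bsurj]] : exists b : G -> H, set_bij X Y b.
  apply: card_eq_set_bij; first exact: 0.
  by apply: Cantor_Bernstein; [exact: (basis_card_le presG presH) | exact:
    (basis_card_le presH presG)].
have [b' hb'] : exists b' : H -> G, forall y, Y y -> X (b' y) /\ b (b' y) = y.
  have h y : exists x, Y y -> X x /\ b x = y.
    have [Yy|nY] := pselect (Y y); last by exists 0.
    by have [x Xx bx] := bsurj y Yy; exists x.
  by have [b' hb'] := choice h; exists b'.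
have bK x : X x -> b' (b x) = x.
  move=> Xx; have [Xb Eb] := hb' _ (bXY _ Xx).
  by apply: binj => //; apply: mem_set.
have [r [rX rA rB runiq]] := basis_mod_coord sG bX.
have [r' [r'Y r'A r'B r'uniq]] := basis_mod_coord sH bY.
have [q hq] : exists q : G -> H, forall g, common rho chi psi g ->
  exists c, chi g = rho c * psi (q g).
  have h g : exists h, common rho chi psi g -> exists c, chi g = rho c * psi h.
    have [[c [h E]]|nC] := pselect (common rho chi psi g); last by exists 0.
    by exists h => _; exists c.
  by have [q hq] := choice h; exists q.
have quniq g c h : chi g = rho c * psi h -> q g = h.
  move=> E; have [|c' E'] := hq g; first by exists c, h.
  have [|//] := @pres_char_inj _ _ _ _ presH (q g) h (c / c').
  rewrite fmorph_div; have /(canRL (mulKf _)) : rho c' * psi (q g) = rho c * psi h by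
    rewrite -E'.
  have c'0 : rho c' != 0.
    apply: contraNneq (char_neq0 chi0 chiD g) => c0; by rewrite E' c0 mul0r.
  by move=> /(_ c'0) ->; rewrite mulrA [(rho c')^-1 * _]mulrC.
have qB g g' : common rho chi psi g -> common rho chi psi g' -> q (g - g') = q g - q g'.
  move=> /hq[c E] /hq[c' E']; apply: (quniq _ (c / c')).
  by rewrite (charB chi0 chiD) E E' (charB psi0 psiD) fmorph_div mulf_div.
have q_common g : common rho chi psi g -> common rho psi chi (q g).
  by move=> /hq[c E]; exists c^-1, g; exact: (common_sym presG E).
pose f g := q (g - int_comb (r g)) + int_comb (push b (r g)).
have fB : zmod_morphism f.
  move=> g g'; rewrite /f rB.
  have -> : g - g' - int_comb (r g - r g') = (g - int_comb (r g)) - (g' - int_comb (r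
    g')).
    by rewrite raddfB !opprB [LHS]addrACA [RHS]addrACA [- g' + _]addrC.
  by rewrite qB // (raddfB (push b)) (raddfB (@int_comb H)) opprD addrACA.
pose F : {additive G -> H} := HB.pack f (GRing.isZmodMorphism.Build _ _ f fB).
exists F; apply: bijective_of_inj_surj => [g g' /eqP|h].
  rewrite -subr_eq0 -raddfB /= => /eqP; set d := g - g'.
  rewrite /f => E; apply/eqP; rewrite -subr_eq0 -/d; apply/eqP.
  have pr0 : push b (r d) = 0.
    case: bY => _ _; apply; first exact: push_supp (rX d).
    have -> : int_comb (push b (r d)) = - q (d - int_comb (r d)).
      by apply/eqP; rewrite -addr_eq0 addrC E.
    by apply: subgroupN => //; exact: q_common.
  have rd0 : r d = 0 by rewrite -(push_cancel bK (rX d)) pr0 raddf0.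
  move: E; rewrite pr0 rd0 (raddf0 (@int_comb G)) (raddf0 (@int_comb H)) addr0 subr0
    => qd0.
  have [|c Ec] := hq d; first by rewrite -[d]subr0 -(raddf0 (@int_comb G)) -rd0.
  have [] // := @pres_char_inj _ _ _ _ presG d 0 c.
  by rewrite Ec qd0 psi0 chi0.
pose m := push b' (r' h).
have mX : supp_in X m by apply: push_supp (r'Y h) => y /hb'[].
have [c [g0 E]] := r'A h.
have E' := common_sym presH E.
have Cg0 : common rho chi psi g0 by exists c^-1, (h - int_comb (r' h)).
exists (g0 + int_comb m).
have rE : r (g0 + int_comb m) = m by apply: runiq => //; rewrite addrK.
rewrite /= /f rE addrK (quniq _ _ _ E') /m (push_cancel _ (r'Y h)) ?subrK //.
by move=> y /hb'[].
Qed.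

(** * Transport of presentations *)

Section Transport.
Variables (G : zmodType) (K : fieldType) (rho : {rmorphism rat -> K}) (chi : G -> K).
Hypothesis pres : presentation rho chi.

Lemma presentation_iso_field (L : fieldType) (f : {rmorphism K -> L}) :
  bijective f -> presentation (f \o rho) (f \o chi).
Proof.
move=> [f' fK f'K].
have E p : mmap (f \o rho) (f \o chi) p = f (mmap rho chi p).
  by rewrite !mmapE rmorph_sum; apply: eq_bigr => g _; rewrite rmorphM.
split.
- by rewrite /= (pres0 pres) rmorph1.
- by move=> g h; rewrite /= (presD pres) rmorphM.
- move=> p; rewrite E => /eqP; rewrite fmorph_eq0 => /eqP; exact: (pres_inj pres).
- move=> x; have [p [q [q0 Ex]]] := pres_frac pres (f' x); exists p, q.
  by rewrite !E fmorph_eq0 -fmorph_div -Ex f'K.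
Qed.

Lemma presentation_iso_group (G' : zmodType) (a : {additive G' -> G}) :
  bijective a -> presentation rho (chi \o a).
Proof.
move=> [b aK bK].
have E p : mmap rho (chi \o a) p = mmap rho chi (push a p).
  by rewrite mmapE raddf_sum; apply: eq_bigr => g _; rewrite /= gevU.
have pushK (p : {malg rat[G]}) : push a (push b p) = p.
  by apply: (@push_cancel _ _ _ _ _ setT) => // g _; exact: bK.
split.
- by rewrite /= raddf0 (pres0 pres).
- by move=> g h; rewrite /= raddfD (presD pres).
- move=> p; rewrite E => /(pres_inj pres) p0.
  rewrite -(@push_cancel _ _ _ a b setT p) ?p0 ?raddf0 // => g _; exact: aK.
- move=> x; have [p [q [q0 Ex]]] := pres_frac pres x; exists (push b p), (push b q).
  by rewrite !E !pushK.
Qed.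

(** A ring has at most one morphism from the rationals. *)
Lemma presentation_rat (rho' : {rmorphism rat -> K}) : presentation rho' chi.
Proof.
have Erho c : rho' c = rho c.
  by rewrite -(divq_num_den c) !fmorph_div !rmorph_int.
have E p : mmap rho' chi p = mmap rho chi p.
  by rewrite !mmapE; apply: eq_bigr => g _; rewrite Erho.
split; [exact: (pres0 pres) | exact: (presD pres) | |].
- by move=> p; rewrite E; exact: (pres_inj pres).
- by move=> x; have [p [q h]] := pres_frac pres x; exists p, q; rewrite !E.
Qed.

End Transport.

Lemma field_isomorphic_of_presentations (G : zmodType) (K L : fieldType)
    (rho : {rmorphism rat -> K}) (chi : G -> K)
    (sigma : {rmorphism rat -> L}) (psi : G -> L) :
  presentation rho chi -> presentation sigma psi -> field_isomorphic K L.
Proof.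
move=> presK presL.
pose ev := mmap rho chi; pose ev' := mmap sigma psi.
have evM p q : ev (gmul p q) = ev p * ev q := gev_gmul rho (presD presK) p q.
have evM' p q : ev' (gmul p q) = ev' p * ev' q := gev_gmul sigma (presD presL) p q.
have evB p q : ev (p - q) = ev p - ev q by exact: raddfB.
have evB' p q : ev' (p - q) = ev' p - ev' q by exact: raddfB.
have ev_inj p q : ev p = ev q -> p = q.
  by move=> E; apply/eqP; rewrite -subr_eq0; apply/eqP/(pres_inj presK);
    rewrite -/ev evB E subrr.
have ev_inj' p q : ev' p = ev' q -> p = q.
  by move=> E; apply/eqP; rewrite -subr_eq0; apply/eqP/(pres_inj presL);
    rewrite -/ev' evB' E subrr.
have ev_eq0 p : (ev p == 0) = (p == 0).
  by apply/eqP/eqP => [/(pres_inj presK)|->] //; exact: raddf0.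
have ev_eq0' p : (ev' p == 0) = (p == 0).
  by apply/eqP/eqP => [/(pres_inj presL)|->] //; exact: raddf0.
have ex x : exists y, forall p q, ev q != 0 -> x = ev p / ev q -> y = ev' p / ev' q.
  have [p [q [q0 E]]] := pres_frac presK x; exists (ev' p / ev' q) => p' q' q'0 E'.
  apply/eqP; rewrite eqr_div ?ev_eq0' -?ev_eq0 // -!evM'; apply/eqP; congr ev'.
  by apply: ev_inj; rewrite !evM; apply/eqP; rewrite -eqr_div // -E -E'.
have [f hf] := choice ex.
have frac x : exists p q, [/\ ev q != 0, ev' q != 0,
  x = ev p / ev q & f x = ev' p / ev' q].
  have [p [q [q0 E]]] := pres_frac presK x; exists p, q; split=> //.
    by rewrite ev_eq0' -ev_eq0.
  exact: hf.
have one : ev << 1 *g 0 >> = 1 by rewrite /ev gevU rmorph1 (pres0 presK) mulr1.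
have one' : ev' << 1 *g 0 >> = 1 by rewrite /ev' gevU rmorph1 (pres0 presL) mulr1.
have fB : zmod_morphism f.
  move=> x y; have [p [q [q0 q0' E ->]]] := frac x.
  have [r [s [s0 s0' E' ->]]] := frac y.
  rewrite (hf _ (gmul p s - gmul r q) (gmul q s)).
  - by rewrite evB' !evM' -[X in _ = _ + X]mulNr addf_div // mulNr.
  - by rewrite evM mulf_neq0.
  - by rewrite evB !evM E E' -[X in _ + X = _]mulNr addf_div // mulNr.
have f1 : f 1 = 1.
  by rewrite (hf 1 << 1 *g 0 >> << 1 *g 0 >>) ?one ?one' ?divr1 // oner_neq0.
have fM x y : f (x * y) = f x * f y.
  have [p [q [q0 q0' E ->]]] := frac x; have [r [s [s0 s0' E' ->]]] := frac y.
  rewrite (hf _ (gmul p r) (gmul q s)).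
  - by rewrite !evM' mulf_div.
  - by rewrite evM mulf_neq0.
  - by rewrite !evM E E' mulf_div.
pose F : {rmorphism K -> L} := HB.pack f (GRing.isZmodMorphism.Build _ _ f fB)
  (GRing.isMonoidMorphism.Build _ _ f (conj f1 fM)).
exists F; apply: bijective_of_inj_surj; first exact: fmorph_inj.
move=> y; have [p [q [q0 E]]] := pres_frac presL y; exists (ev p / ev q).
by rewrite E /=; apply: hf => //; rewrite ev_eq0 -ev_eq0'.
Qed.

(** * Purely transcendental extensions of [KQ G] *)

Lemma fraction_numden (R : idomainType) (a : {fraction R}) :
  exists n d : R, d != 0 /\ a = FracField.tofrac n / FracField.tofrac d.
Proof.
elim/quotW: a => x; exists (frac x).1, (frac x).2; split; first exact: denom_ratioP.
apply: (canRL (mulfK _)); first by rewrite tofrac_eq0 denom_ratioP.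
rewrite -[LHS]/(FracField.mul _ _) !piE; apply/eqmodP.
rewrite /= FracField.equivfE /FracField.mulf !numden_Ratio ?mulr1 ?oner_neq0
  ?mulf_neq0 ?denom_ratioP //.
by rewrite mulrC.
Qed.

Lemma groupAlg_mulUU (G : zmodType) (c d : rat) (g h : G) :
  (<< c *g g >> : groupAlg G) * << d *g h >> = << c * d *g g + h >>.
Proof.
apply/malgP => k; rewrite mcoeff_groupAlgM mcoeffU.
have [->|c0] := eqVneq c 0; first by rewrite msuppU eqxx big_seq_fset0 mul0r mul0rn.
have [->|d0] := eqVneq d 0.
  by rewrite big1 ?mulr0 ?mul0rn // => g' _; rewrite msuppU eqxx big_seq_fset0.
by rewrite !msuppU (negbTE c0) (negbTE d0) !big_seq_fset1 !mcoeffUU.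
Qed.

Section Adjoin.
Variables (G : torsionFreeZmodType) (I : choiceType) (L : fieldType).
Variables (iota : {rmorphism KQ G -> L}) (t : I -> L).
Hypothesis indep : alg_independent iota t.
Local Notation A := (adjoin iota t).
Local Notation tofrac := (@FracField.tofrac (groupAlg G)).

Definition gconst (c : rat) : groupAlg G := << c *g 0 >>.

Lemma gconst_zmod_morphism : zmod_morphism gconst.
Proof. by move=> c d; rewrite /gconst monalgUB. Qed.

Lemma gconst_monoid_morphism : monoid_morphism gconst.
Proof. by split=> // c d; rewrite /gconst groupAlg_mulUU addr0. Qed.

HB.instance Definition _ := GRing.isZmodMorphism.Build _ _ gconst gconst_zmod_morphism.
HB.instance Definition _ := GRing.isMonoidMorphism.Build _ _ gconst
  gconst_monoid_morphism.

Lemma iota_adjoin a : iota a \in adjoin_pred iota t.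
Proof. by apply/asboolP => S _ Sa _; exact: Sa. Qed.

Lemma t_adjoin i : t i \in adjoin_pred iota t.
Proof. by apply/asboolP => S _ _ St; exact: St. Qed.

Definition emb (a : KQ G) : A := Adjoin (iota_adjoin a).
Definition gen (i : I) : A := Adjoin (t_adjoin i).

Definition aval : {rmorphism A -> L} := \val.

Lemma emb_zmod_morphism : zmod_morphism emb.
Proof. by move=> a b; apply: val_inj; rewrite /= rmorphB. Qed.

Lemma emb_monoid_morphism : monoid_morphism emb.
Proof.
by split=> [|a b]; apply: val_inj; rewrite /= ?rmorph1 ?rmorphM.
Qed.

HB.instance Definition _ := GRing.isZmodMorphism.Build _ _ emb emb_zmod_morphism.
HB.instance Definition _ := GRing.isMonoidMorphism.Build _ _ emb emb_monoid_morphism.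

Lemma monom_evalU (i : I) : monom_eval t (ucm i) = t i.
Proof. by rewrite /monom_eval mdomU big_seq_fset1 cmUU expr1. Qed.

Lemma poly_evalU (c : KQ G) (m : {cmonom I}) :
  mmap iota (monom_eval t) << c *g m >> = iota c * monom_eval t m.
Proof. by rewrite mmapU. Qed.

Lemma gen_neq0 i : gen i != 0.
Proof.
apply/eqP => /(congr1 val) /= ti0.
have : << 1 *g ucm i >> = 0 :> {malg (KQ G)[{cmonom I}]}.
  by apply: indep; rewrite poly_evalU monom_evalU ti0 mulr0.
by move/eqP; rewrite monalgU_eq0 oner_eq0.
Qed.

Definition gen_prod (m : {malg int[I]}) : A := \prod_(i <- msupp m) gen i ^ m@_i.

Lemma gen_prod_widen (d : {fset I}) m :
  (msupp m `<=` d)%fset -> gen_prod m = \prod_(i <- d) gen i ^ m@_i.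
Proof.
move=> le; rewrite /gen_prod (big_fset_incl _ le) //= => x _ /mcoeff_outdom ->.
by rewrite expr0z.
Qed.

Lemma gen_prodD m m' : gen_prod (m + m') = gen_prod m * gen_prod m'.
Proof.
rewrite (gen_prod_widen (msuppD_le m m')).
rewrite (gen_prod_widen (fsubsetUl (msupp m) (msupp m'))).
rewrite (gen_prod_widen (fsubsetUr (msupp m) (msupp m'))).
by rewrite -big_split /=; apply: eq_bigr => i _; rewrite mcoeffD expfzDr // gen_neq0.
Qed.

Lemma gen_prod0 : gen_prod 0 = 1.
Proof. by rewrite /gen_prod msupp0 big_seq_fset0. Qed.

Lemma gen_prodU i : gen_prod << 1 *g i >> = gen i.
Proof. by rewrite (gen_prod_widen msuppU_le) big_seq_fset1 mcoeffUU expr1z. Qed.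

Definition exponents (m : {malg int[I]}) : {cmonom I} :=
  [cmonom `|m@_i|%N | i in msupp m]%M.

Lemma exponentsE m i : exponents m i = `|m@_i|%N.
Proof. by rewrite cmE fsfun_fun; case: msuppP. Qed.

Lemma monom_eval_exponents m : (forall i, 0 <= m@_i) ->
  monom_eval t (exponents m) = aval (gen_prod m).
Proof.
move=> m0; have supp : finsupp (exponents m) = msupp m.
  by apply/fsetP => i; rewrite -cmE_neq0 exponentsE absz_eq0 mcoeff_neq0.
rewrite /monom_eval supp /gen_prod rmorph_prod; apply: eq_bigr => i _.
by rewrite exponentsE fmorphXz exprnP gez0_abs.
Qed.

Lemma exponents_inj m m' : (forall i, 0 <= m@_i) -> (forall i, 0 <= m'@_i) ->
  exponents m = exponents m' -> m = m'.
Proof.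
move=> m0 m'0 E; apply/malgP => i.
by rewrite -[m@_i]gez0_abs // -[m'@_i]gez0_abs // -!exponentsE E.
Qed.

(** [N] dominates the negative exponents of finitely many monomials. *)
Lemma exists_shift (s : seq (G * {malg int[I]})) : exists N : {malg int[I]},
  (forall i, 0 <= N@_i) /\ forall x, x \in s -> forall i, 0 <= (x.2 + N)@_i.
Proof.
elim: s => [|x s [N [N0 hN]]]; first by exists 0; split=> // i; rewrite mcoeff0.
pose ab := \sum_(i <- msupp x.2) << `|x.2@_i| *g i >> : {malg int[I]}.
have abE i : ab@_i = `|x.2@_i|.
  rewrite raddf_sum /= (eq_bigr (fun j => if j == i then `|x.2@_i| else 0)); last first.
    by move=> j _; rewrite mcoeffU; case: eqP => [->|].
  have [is_|is_] := boolP (i \in msupp x.2).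
    rewrite (big_fsetD1 i) //= eqxx big1_seq ?addr0 // => j /andP[_].
    by rewrite in_fsetD1 => /andP[/negbTE ->].
  rewrite big1_seq ?(mcoeff_outdom is_) ?normr0 // => j /andP[_ js].
  by case: eqP => // e; rewrite -e js in is_.
exists (N + ab); split=> [i|y]; first by rewrite mcoeffD abE addr_ge0.
rewrite in_cons => /orP[/eqP -> i|ys i].
  rewrite !mcoeffD abE addrCA addr_ge0 // -lerBlDl sub0r.
  by rewrite -normrN ler_norm.
by rewrite addrA mcoeffD abE addr_ge0 // hN.
Qed.

Definition adjoin_rat : {rmorphism rat -> A} := emb \o tofrac \o gconst.

Definition adjoin_char (x : G * {malg int[I]}) : A :=
  emb (tofrac (<< x.1 >> : groupAlg G)) * gen_prod x.2.

Lemma adjoin_char0 : adjoin_char 0 = 1.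
Proof.
rewrite /adjoin_char /= gen_prod0 mulr1.
have -> : tofrac << 0 >> = 1 by exact: rmorph1.
by rewrite rmorph1.
Qed.

Lemma adjoin_charD x y : adjoin_char (x + y) = adjoin_char x * adjoin_char y.
Proof.
rewrite /adjoin_char /= gen_prodD mulrACA -groupAlg_monomM.
by rewrite !rmorphM.
Qed.

Lemma adjoin_rat_char c x : adjoin_rat c * adjoin_char x =
  emb (tofrac (<< c *g x.1 >> : groupAlg G)) * gen_prod x.2.
Proof.
rewrite /adjoin_char mulrA; congr (_ * _).
by rewrite /= -!rmorphM /gconst groupAlg_mulUU mulr1 add0r.
Qed.

(** A relation between the units, once shifted to nonnegative exponents, is a
    polynomial relation between the [t i] over [KQ G]. *)
Lemma adjoin_inj p : mmap adjoin_rat adjoin_char p = 0 -> p = 0.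
Proof.
move=> ev0; have [N [_ hN]] := exists_shift (msupp p).
pose mono (x : G * {malg int[I]}) := exponents (x.2 + N).
pose P : {malg (KQ G)[{cmonom I}]} :=
  \sum_(x <- msupp p) << tofrac (<< p@_x *g x.1 >> : groupAlg G) *g mono x >>.
have P0 : P = 0.
  apply: indep; rewrite raddf_sum /=.
  have -> : \sum_(x <- msupp p) mmap iota (monom_eval t)
      << tofrac (<< p@_x *g x.1 >> : groupAlg G) *g mono x >> =
      aval (mmap adjoin_rat adjoin_char p * gen_prod N).
    rewrite [mmap adjoin_rat _ _]mmapE mulr_suml (rmorph_sum aval).
    rewrite big_seq [RHS]big_seq; apply: eq_bigr => x xp.
    rewrite poly_evalU monom_eval_exponents; last exact: hN.
    by rewrite gen_prodD adjoin_rat_char !(rmorphM aval) mulrA.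
  by rewrite ev0 mul0r rmorph0.
apply/malgP => x0; rewrite mcoeff0.
have [xp|/mcoeff_outdom //] := boolP (x0 \in msupp p).
have : tofrac (\sum_(x <- msupp p | x.2 == x0.2) (<< p@_x *g x.1 >> : groupAlg G)) = 0.
  have := congr1 (mcoeff (mono x0)) P0; rewrite mcoeff0 raddf_sum /= => <-.
  rewrite raddf_sum /= big_seq_cond [RHS]big_seq [RHS](bigID (fun x => x.2 == x0.2)) /=.
  rewrite [X in _ = _ + X]big1 ?addr0.
    by apply: eq_bigr => x /andP[_ /eqP e]; rewrite /mono e mcoeffUU.
  move=> x /andP[xs ne]; rewrite mcoeffU; case: eqP => // e.
  case/eqP: ne; apply: (addIr N); apply: exponents_inj e; exact: hN.
move/eqP; rewrite tofrac_eq0 => /eqP /(congr1 (mcoeff x0.1)).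
rewrite mcoeff0 raddf_sum /= big_mkcond /= => E; rewrite -[RHS]E.
rewrite (big_fsetD1 x0) //= eqxx mcoeffUU big1_seq ?addr0 // => x /andP[_].
rewrite in_fsetD1 mcoeffU => /andP[/eqP ne _]; case: eqP => // e; case: eqP => // e1.
by case: ne; rewrite [x]surjective_pairing [x0]surjective_pairing e e1.
Qed.

(** The quotients of the values of the group algebra form a subfield that contains
    [KQ G] and the [t i], hence all of the adjunction. *)
Lemma adjoin_frac (x : A) : exists p q, mmap adjoin_rat adjoin_char q != 0 /\
  x = mmap adjoin_rat adjoin_char p / mmap adjoin_rat adjoin_char q.
Proof.
pose S : {pred L} := [pred y | `[< exists2 z : A,
  fieldOf adjoin_rat adjoin_char setT z & aval z = y >]].
have sT : is_subgroup [set: G * {malg int[I]}] by split.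
have [F1 FB FD] := fieldOf_divring adjoin_rat adjoin_char0 adjoin_charD sT.
have [z Fz /val_inj <-] : exists2 z : A, fieldOf adjoin_rat adjoin_char setT z & aval
  z = aval x.
  apply/asboolP; have /asboolP /(_ S) h := valP x; apply: h.
  - split.
    + by apply/asboolP; exists 1; [exact/asboolP | rewrite rmorph1].
    + move=> _ _ /asboolP[y Fy <-] /asboolP[z Fz <-]; apply/asboolP; exists (y - z).
        by apply/asboolP; apply: FB; apply/asboolP.
      by rewrite rmorphB.
    + move=> _ _ /asboolP[y Fy <-] /asboolP[z Fz <-]; apply/asboolP; exists (y / z).
        by apply/asboolP; apply: FD; apply/asboolP.
      by rewrite fmorph_div.
  - move=> a; apply/asboolP; exists (emb a) => //.
    have Falg (n : groupAlg G) : fieldOf adjoin_rat adjoin_char setT (emb (tofrac n)).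
      exists (push (fun g => (g, 0)) n), << 1 *g 0 >>; split=> //.
        by rewrite gevU rmorph1 mul1r adjoin_char0 oner_neq0.
      rewrite [X in _ / X]gevU rmorph1 mul1r adjoin_char0 divr1.
      rewrite [in LHS](monalgE n) /push !raddf_sum; apply: eq_bigr => g _.
      by rewrite [RHS]gevU adjoin_rat_char /= gen_prod0 mulr1.
    have [n [d [d0 ->]]] := fraction_numden a; rewrite fmorph_div.
    by apply/asboolP; apply: FD; apply/asboolP.
  - move=> i; apply/asboolP; exists (gen i) => //.
    have -> : gen i = adjoin_char (0, << 1 *g i >>).
      rewrite /adjoin_char /= gen_prodU.
      have -> : tofrac << 0 >> = 1 by exact: rmorph1.
      by rewrite rmorph1 mul1r.
    exact: (fieldOf_psi adjoin_rat adjoin_char0).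
by case: Fz => p [q [_ _ q0 ->]]; exists p, q.
Qed.

Lemma presentation_adjoin : presentation adjoin_rat adjoin_char.
Proof.
split; [exact: adjoin_char0|exact: adjoin_charD|exact: adjoin_inj|exact: adjoin_frac].
Qed.

End Adjoin.

Lemma torsion_free_prod (G : torsionFreeZmodType) (I : choiceType)
    (x : G * {malg int[I]}) n : (0 < n)%N -> x *+ n = 0 -> x = 0.
Proof.
move=> n0 xn.
have pairMn k : x *+ k = (x.1 *+ k, x.2 *+ k).
  by elim: k => [|k IH]; rewrite ?mulr0n // !mulrS IH.
move: xn; rewrite pairMn => -[/(torsion_free _ _ n0) x1 x2].
rewrite [x]surjective_pairing x1; congr pair; apply/malgP => i.
have /eqP := congr1 (mcoeff i) x2; rewrite mcoeffMn !mcoeff0 mulrn_eq0.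
by rewrite eqn0Ngt n0 => /eqP.
Qed.

Theorem corollary6p1
  (G H : torsionFreeZmodType) (I J : choiceType)
  (L : fieldType) (iota : {rmorphism KQ G -> L}) (t : I -> L)
  (ht : alg_independent iota t)
  (M : fieldType) (kappa : {rmorphism KQ H -> M}) (u : J -> M)
  (hu : alg_independent kappa u) :
  field_isomorphic (adjoin iota t) (adjoin kappa u) <->
  group_isomorphic (G * {malg int[I]})%type (H * {malg int[J]})%type.
Proof.
have presG := presentation_adjoin ht; have presH := presentation_adjoin hu.
split=> [[f fbij]|[a abij]].
  apply: (group_isomorphic_of_presentations (@torsion_free_prod G I)
    (@torsion_free_prod H J) (presentation_iso_field presG fbij)).
  exact: (presentation_rat presH).
exact: (field_isomorphic_of_presentations presG (presentation_iso_group presH abij)).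
Qed.
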